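(* Let $N=1$ and consider the system $$\dot{\boldsymbol{a}}_j-\lambda d_j\mathbb{J}\dot{\boldsymbol{a}}_j=-\frac1\pi\nabla_{\boldsymbol{a}_j}W(\boldsymbol{a};\boldsymbol{q}(\boldsymbol{a})),\qquad \boldsymbol{a}_j(0)=\boldsymbol{a}_j^0,\qquad j=1,2.$$ If the initial data $\boldsymbol a^0=(\boldsymbol a_1^0,\boldsymbol a_2^0)\in(\mathbb{T}^2)^2_*$ satisfies $$\boldsymbol a_1^0=(0.5,0.5)^T+(\alpha^0,\beta^0)^T,\qquad \boldsymbol a_2^0=(0.5,0.5)^T+(-\alpha^0,\beta^0)^T,$$ then the solution $\boldsymbol a=\boldsymbol a(t)=(\boldsymbol a_1(t),\boldsymbol a_2(t))$ is of the form $$\boldsymbol a_1(t)=(0.5,0.5)^T+(\alpha(t),\beta(t))^T,\qquad \boldsymbol a_2(t)=(0.5,0.5)^T+(-\alpha(t),\beta(t))^T,$$ where $\alpha,\beta$ satisfy $$\dot\alpha=\frac{-2(\partial_xF(2\alpha,0)+4\pi\alpha)}{1+\lambda^2},\qquad \dot\beta=\frac{2\lambda(\partial_xF(2\alpha,0)+4\pi\alpha)}{1+\lambda^2},$$ with initial data $\alpha(0)=\alpha^0$, $\beta(0)=\beta^0$. In particular, the trajectory of the solution $\boldsymbol a$ consists of two segments.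
   Context: $\mathbb{T}^2=(\mathbb{R}/\mathbb{Z})^2$ is the unit torus; $\lambda\in\mathbb{R}$; $(\mathbb{T}^2)^{2}_*$ is the set of pairs of distinct points of $\mathbb{T}^2$; $d_1=1$, $d_2=-1$; $\mathbb{J}=\begin{pmatrix}0&1\\-1&0\end{pmatrix}$. $F$ solves $\Delta F=2\pi(\delta-1)$ on $\mathbb{T}^2$ (with $\delta$ the Dirac mass at $\boldsymbol 0$) and $\int_{\mathbb{T}^2}F\,d\boldsymbol x=0$. For $\boldsymbol a\in(\mathbb{T}^2)^2_*$ and $\boldsymbol q\in2\pi\sum_{j=1}^2d_j\boldsymbol a_j+2\pi\mathbb{Z}^2$, the renormalized energy is $$W(\boldsymbol a;\boldsymbol q)=-\pi\sum_{1\le j\ne k\le2}d_jd_kF(\boldsymbol a_j-\boldsymbol a_k)+\tfrac12|\boldsymbol q|^2.$$ In the system, $t\mapsto\boldsymbol q(\boldsymbol a(t))\in\mathbb{R}^2$ is the unique continuous map with $\boldsymbol q(\boldsymbol a(0))=\boldsymbol q_0$ and $\boldsymbol q(\boldsymbol a(t))\in2\pi\sum_{j}d_j\boldsymbol a_j(t)+2\pi\mathbb{Z}^2$, for a given $\boldsymbol q_0\in2\pi\sum_{j}d_j\boldsymbol a_j^0+2\pi\mathbb{Z}^2$. In the gradient the dependence of $\boldsymbol q$ on $\boldsymbol a$ is included (locally $\boldsymbol q=2\pi\sum_kd_k\boldsymbol a_k+2\pi\boldsymbol k$ with constant $\boldsymbol k\in\mathbb{Z}^2$), so $$\nabla_{\boldsymbol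 a_j}W(\boldsymbol a;\boldsymbol q)=2\pi d_j\Bigl(-\sum_{k\ne j}d_k\nabla F(\boldsymbol a_j-\boldsymbol a_k)+\boldsymbol q\Bigr).$$
   Formalization: The initial flux is fixed as q_0 = (4πα^0, 0), the branch computed from the given representatives of a_1^0 and a_2^0; for any other admissible q_0 the stated form or the stated equations for α, β fail. *)

(* Defs.v *)
From HB Require Import structures.
From mathcomp Require Import all_boot all_order all_algebra.
From mathcomp Require Import ring_quotient.
From mathcomp Require Import all_classical all_reals all_analysis.

Set Implicit Arguments.
Unset Strict Implicit.
Unset Printing Implicit Defensive.

Import Order.TTheory GRing.Theory Num.Theory.
Import numFieldNormedType.Exports.

Local Open Scope classical_set_scope.
Local Open Scope ring_scope.

(* R^2 / Z^2 with its quotient group structure and its quotient topology. *)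
Definition in_lattice (R : realType) (x : 'cV[R]_2) : bool :=
  [forall i, x i 0 \is a Num.int].

Lemma lattice_zmod_closed (R : realType) : zmod_closed (@in_lattice R).
Proof.
split=> [|x y /forallP xZ /forallP yZ]; apply/forallP => i; rewrite !mxE.
  exact: rpred0.
exact: rpredB (xZ i) (yZ i).
Qed.

HB.instance Definition _ (R : realType) :=
  GRing.isZmodClosed.Build 'cV[R]_2 (@in_lattice R) (@lattice_zmod_closed R).

Definition lattice (R : realType) : zmodClosed 'cV[R]_2 :=
  GRing.ZmodClosed.clone 'cV[R]_2 (@in_lattice R) _.

Definition torus (R : realType) : Type := {ideal_quot (lattice R)}.

HB.instance Definition _ (R : realType) :=
  GRing.Zmodule.copy (torus R) {ideal_quot (lattice R)}.
Definition to_torus (R : realType) (x : 'cV[R]_2) : torus R :=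
  (\pi_({ideal_quot (lattice R)}) x)%qT.

Section TorusTopology.
Variable R : realType.

Definition torus_open (U : set (torus R)) : Prop :=
  open (@to_torus R @^-1` U).

Lemma torus_openT : torus_open setT.
Proof. exact: openT. Qed.

Lemma torus_openI (A B : set (torus R)) :
  torus_open A -> torus_open B -> torus_open (A `&` B).
Proof. exact: openI. Qed.

Lemma torus_open_bigU (I : Type) (f : I -> set (torus R)) :
  (forall i, torus_open (f i)) -> torus_open (\bigcup_i f i).
Proof. by move=> fo; apply: bigcup_open => i _; apply: fo. Qed.

HB.instance Definition _ := isOpenTopological.Build (torus R)
  torus_openT torus_openI torus_open_bigU.

End TorusTopology.

Definition vec2 (R : realType) (x y : R) : 'cV[R]_2 :=
  \col_i (if i == 0 then x else y).

Section Calculus.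
Variable R : realType.
Implicit Types (f : 'cV[R]_2 -> R) (g : torus R -> R).

Definition partial (i : 'I_2) f : 'cV[R]_2 -> R :=
  fun x => 'D_(delta_mx i 0) f x.

Definition grad f (x : 'cV[R]_2) : 'cV[R]_2 := \col_i partial i f x.

Definition laplacian f (x : 'cV[R]_2) : R := \sum_i partial i (partial i f) x.

(* C^oo on U, for U open: all iterated partial derivatives are differentiable
   (hence also continuous) at every point of U. *)
Definition smooth_on (U : set 'cV[R]_2) f : Prop :=
  forall (s : seq 'I_2) (x : 'cV[R]_2), U x ->
    differentiable (foldr partial f s) x.

(* A function on the torus, seen in the coordinates of the unit square. *)
Definition on_square f (z : measurableTypeR R * measurableTypeR R) : R :=
  f (vec2 z.1 z.2).

Definition unit_square : set (measurableTypeR R * measurableTypeR R) :=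
  `[0, 1[ `*` `[0, 1[.

Definition area := (@lebesgue_measure R \x @lebesgue_measure R)%E.

Definition torus_int f : R := \int[area]_(z in unit_square) on_square f z.

(* Laplacian F = 2 pi (delta_0 - 1) in the sense of distributions, with zero
   mean.  This determines F up to a null set; F is taken to be the
   representative that is smooth away from 0.  The value F 0 is irrelevant. *)
Record is_green (F : torus R -> R) : Prop := IsGreen {
  green_smooth : smooth_on [set x | to_torus x <> 0] (F \o @to_torus R) ;
  green_integrable :
    area.-integrable unit_square (EFin \o on_square (F \o @to_torus R)) ;
  green_mean : torus_int (F \o @to_torus R) = 0 ;
  green_eq : forall g, smooth_on setT (g \o @to_torus R) ->
    torus_int (fun x => F (to_torus x) * laplacian (g \o @to_torus R) x) =
    2 * pi * (g 0 - torus_int (g \o @to_torus R)) }.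

End Calculus.

Section Vortices.
Variable R : realType.
Implicit Types (F : torus R -> R) (a : 'I_2 -> torus R) (q : 'cV[R]_2).

(* The indices 0 and 1 of 'I_2 stand for the vortices 1 and 2. *)
Definition deg (j : 'I_2) : R := if j == 0 then 1 else -1.

Definition JJ : 'M[R]_2 :=
  \matrix_(i, j) (if (i == 0) && (j == 1) then 1
                  else if (i == 1) && (j == 0) then -1 else 0).

Definition distinct_pair a : Prop := a 0 <> a 1.

(* The set 2 pi sum_j d_j a_j + 2 pi Z^2. *)
Definition flux_set a : set 'cV[R]_2 :=
  [set q | exists (x : 'I_2 -> 'cV[R]_2) (k : 'cV[R]_2),
    [/\ forall j, to_torus (x j) = a j, k \in lattice R
      & q = (2 * pi) *: (\sum_j deg j *: x j) + (2 * pi) *: k]].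

Definition energy F a q : R :=
  - pi * (\sum_j \sum_(k | k != j) deg j * deg k * F (a j - a k))
  + 2^-1 * \sum_i q i 0 ^+ 2.

(* Gradient in a_j at (a, q), where q moves with a_j along the branch
   q = 2 pi sum_k d_k a_k + 2 pi k with k constant: when a_j is displaced
   by h, q is displaced by 2 pi d_j h. *)
Definition grad_energy F (j : 'I_2) a q : 'cV[R]_2 :=
  grad (fun h => energy F (fun k => if k == j then a k + to_torus h else a k)
                        (q + (2 * pi * deg j) *: h)) 0.

(* Velocity of a curve in the torus, computed in any local lift to R^2. *)
Definition has_velocity (c : R -> torus R) (t : R) (v : 'cV[R]_2) : Prop :=
  exists A : R -> 'cV[R]_2,
    (\forall s \near t, to_torus (A s) = c s) /\ is_derive t 1 A v.

(* [0, T[, where T may be +oo. *)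
Definition lifespan (T : \bar R) : set R := [set t | 0 <= t /\ (t%:E < T)%E].

(* A solution on [0, T[ together with the continuous branch q of the flux.
   The equation is imposed at interior times, continuity up to t = 0. *)
Record is_solution (lam : R) F (a0 : 'I_2 -> torus R) (q0 : 'cV[R]_2)
    (T : \bar R) (a : R -> 'I_2 -> torus R) (q : R -> 'cV[R]_2) : Prop :=
  IsSolution {
  sol_continuous : forall j, {within lifespan T, continuous (fun t => a t j)} ;
  sol_distinct : forall t, lifespan T t -> distinct_pair (a t) ;
  sol_init : forall j, a 0 j = a0 j ;
  flux_continuous : {within lifespan T, continuous q} ;
  flux_init : q 0 = q0 ;
  flux_branch : forall t, lifespan T t -> flux_set (a t) (q t) ;
  sol_ode : forall t, 0 < t -> (t%:E < T)%E -> forall j,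
    exists v : 'cV[R]_2, has_velocity (fun s => a s j) t v /\
      v - (lam * deg j) *: (JJ *m v) = - pi^-1 *: grad_energy F j (a t) (q t) }.

(* Projection of a bounded straight segment, with or without its endpoints
   (a solution need not reach its limit points).  I may be a single point, as
   happens for stationary solutions. *)
Definition is_segment (S : set (torus R)) : Prop :=
  exists (p v : 'cV[R]_2) (I : set R),
    [/\ v != 0, I !=set0, is_interval I, bounded_set I
      & S = [set to_torus (p + s *: v) | s in I]].

End Vortices.

(* Main.v *)
Require Import Defs.
From HB Require Import structures.
From mathcomp Require Import all_boot all_order all_algebra.
From mathcomp Require Import all_classical all_reals all_analysis.
From mathcomp Require Import ring_quotient measurable_realfun.
From mathcomp Require Import ring lra zify.

(** Why the theorem holds.

    Subtracting the two equations gives an autonomous system for the relative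
    position. The flux q is a continuous choice of 2 pi times a lift of
    a_1 - a_2, so r = q / (2 pi) lifts a_1 - a_2 to the plane, and
      r' = - 4 (grad F (r) + 2 pi r) / (1 + lam^2).
    The data put r(0) on the horizontal axis. Since F is invariant under
    (x, y) -> (x, - y), its partial derivative in y vanishes on that axis, the
    axis is invariant under the flow, and r(t) = (2 alpha(t), 0) for all t
    ([sep1_eq0]). The equations of the single vortices then read
    a_1' = (alpha', beta') and a_2' = (- alpha', beta') with
    beta' = - lam alpha', so beta - beta0 = - lam (alpha - alpha0) and both
    trajectories lie on straight lines. They are bounded because the vortices
    do not meet: 2 alpha(t) is never an integer, hence stays between two
    consecutive integers.

    The substantial point is the symmetry of F ([green_sym]), which amounts to
    the uniqueness of the Green function. Testing the equation of F against
    the waves cos (2 pi (m x + n y) + p), which are eigenfunctions of the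
    Laplacian, gives the moments of F; they depend on m and n only through
    m^2 + n^2 ([green_wave]). So F has the same pairing with a trigonometric
    polynomial as with its reflection. Now take powers of the polynomial [peak],
    which has values in [0, 1] and equals 1 only at one point of the torus:
    they concentrate at that point ([peak_concentration]). If F differed at a
    point v and at its reflection w, with c the mean of the two values, the
    pairings of F - c with high powers of the peaks at v and at w would have
    opposite signs, although they are equal ([green_le]). This route involves
    no change of variables in the integral.

    Two arguments avoid lifting curves from the torus to the plane. The
    velocity at a time t only gives a lift that is differentiable at t; it
    differs from r by a lattice-valued function continuous at t, hence locally
    constant, so that r is differentiable ([sep_derive]). And two curves with
    the same initial point and the same velocity are equal, because the cosine
    of 2 pi times a coordinate of their difference has zero derivative
    ([torus_curve_coord]). *)

Import Order.TTheory GRing.Theory Num.Theory.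
Import numFieldNormedType.Exports.

Local Open Scope classical_set_scope.
Local Open Scope ring_scope.

Set Implicit Arguments.
Unset Strict Implicit.
Unset Printing Implicit Defensive.

(** * The flat torus and its lattice *)

Section Torus.
Variable R : realType.
Implicit Types x y : 'cV[R]_2.

Lemma to_torusD x y : to_torus (x + y) = to_torus x + to_torus y.
Proof. by rewrite /to_torus raddfD. Qed.

Lemma to_torusN x : to_torus (- x) = - to_torus x.
Proof. by rewrite /to_torus raddfN. Qed.

Lemma to_torusB x y : to_torus (x - y) = to_torus x - to_torus y.
Proof. by rewrite /to_torus raddfB. Qed.

Lemma to_torus0 : to_torus (0 : 'cV[R]_2) = 0.
Proof. by rewrite /to_torus raddf0. Qed.

Lemma latticeP x : reflect (forall i, x i 0 \is a Num.int) (x \in lattice R).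
Proof. exact: forallP. Qed.

Lemma to_torus_eq x y : (to_torus x = to_torus y) <-> x - y \in lattice R.
Proof.
by rewrite /to_torus (rwP eqP) -Quotient.idealrBE.
Qed.

Lemma to_torus_eq0 x : (to_torus x = 0) <-> x \in lattice R.
Proof. by rewrite -to_torus0 to_torus_eq subr0. Qed.

Lemma to_torus_surj (t : torus R) : exists x, to_torus x = t.
Proof. by exists (repr t); rewrite /to_torus reprK. Qed.

(** Functions on the torus that are used as test functions arise this way from
    periodic functions on the plane. *)
Lemma torus_factor (T : Type) (e : 'cV[R]_2 -> T) :
  (forall x y, y \in lattice R -> e (x + y) = e x) ->
  exists g : torus R -> T, g \o @to_torus R = e.
Proof.
move=> per; exists (fun t => e (repr t)); apply/funext => x /=.
have : repr (to_torus x) - x \in lattice R.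
  by apply/to_torus_eq; rewrite /to_torus reprK.
by move=> /(per x); rewrite subrKC.
Qed.

Lemma vec2E0 (x y : R) : vec2 x y 0 0 = x. Proof. by rewrite mxE. Qed.
Lemma vec2E1 (x y : R) : vec2 x y 1 0 = y. Proof. by rewrite mxE. Qed.

Lemma ord2P (P : 'I_2 -> Prop) : P 0 -> P 1 -> forall i, P i.
Proof.
move=> P0 P1 [[|[|//]] h]; [move: P0 | move: P1]; congr P; exact/val_inj.
Qed.

Lemma cV2P (x y : 'cV[R]_2) : x 0 0 = y 0 0 -> x 1 0 = y 1 0 -> x = y.
Proof. by move=> h0 h1; apply/colP; apply: ord2P. Qed.

Lemma vec2_eta x : vec2 (x 0 0) (x 1 0) = x.
Proof. by apply: cV2P; rewrite ?vec2E0 ?vec2E1. Qed.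

End Torus.

Section Cos.
Variable R : realType.
Implicit Types u d : R.

Lemma cos2piDint u (m : int) : cos (2 * pi * (u + m%:~R)) = cos (2 * pi * u).
Proof.
have N (v : R) (n : nat) : cos (2 * pi * (v + n%:R)) = cos (2 * pi * v).
  have -> : 2 * pi * (v + n%:R) = 2 * pi * v + (pi *+ 2) *+ n.
    by rewrite mulr2n -[_ *+ n]mulr_natr; ring.
  by rewrite (periodicn (@cosD2pi R)).
case: m => n; first exact: N.
by rewrite NegzE rmorphN /= -(N (u - _) n.+1) subrK.
Qed.

Lemma near_int u : exists m : int, `|u - m%:~R| <= 2^-1.
Proof.
exists (Num.floor (u + 2^-1)).
have /andP[] := floor_itv (u + 2^-1); rewrite rmorphD /= => h1 h2.
by rewrite ler_norml; apply/andP; split; lra.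
Qed.

(** The cosine decreases on [0, pi], so after reduction of u to [-1/2, 1/2] its
    value controls the distance to the nearest integer. *)
Lemma cos2pi_gt u d : 0 < d -> d < 2^-1 ->
  cos (2 * pi * d) < cos (2 * pi * u) ->
  exists m : int, `|u - m%:~R| < d.
Proof.
move=> d0 d1; have [m hm] := near_int u => h; exists m.
rewrite -[u](@subrK _ m%:~R) cos2piDint in h.
move: (u - m%:~R) hm h => v hv.
have -> : cos (2 * pi * v) = cos (2 * pi * `|v|).
  by case: (ger0P v) => // _; rewrite mulrN cosN.
have p0 := pi_gt0 R.
rewrite ltr_cos ?ltr_pM2l ?mulr_gt0 //.
all: rewrite in_itv /=; apply/andP; split; try nra.
by have := normr_ge0 v; nra.
Qed.

Lemma cos2pi_eq1 u : cos (2 * pi * u) = 1 -> u \is a Num.int.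
Proof.
move=> h; have p0 := pi_gt0 R.
have [m hm] := near_int u.
have hh : cos (2 * pi * (u - m%:~R)) = 1.
  by rewrite -(@cos2piDint _ m) subrK.
case: (eqVneq u m%:~R) => [->|ne]; first by rewrite intr_int.
have n0 : 0 < `|u - m%:~R| by rewrite normr_gt0 subr_eq0.
have : cos (2 * pi * (u - m%:~R)) < cos 0.
  have -> : cos (2 * pi * (u - m%:~R)) = cos (2 * pi * `|u - m%:~R|).
    by case: (ger0P (u - m%:~R)) => // _; rewrite mulrN cosN.
  rewrite ltr_cos ?mulr_gt0 // in_itv /= ?lexx ?pi_ge0 //.
  by apply/andP; split; nra.
by rewrite cos0 hh ltxx.
Qed.

Lemma cos2pi_int u : u \is a Num.int -> cos (2 * pi * u) = 1.
Proof. by move=> /intrP[m ->]; rewrite -[m%:~R]add0r cos2piDint mulr0 cos0. Qed.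

End Cos.

Section Lattice.
Variable R : realType.

Lemma coord_cvg (i : 'I_2) : continuous (fun x : 'cV[R]_2 => x i 0).
Proof. by move=> x; exact: coord_continuous. Qed.

(** A continuous function whose level set is the lattice; it shows that the
    lattice is closed. *)
Lemma lattice_cos (x : 'cV[R]_2) :
  (x \in lattice R) <-> cos (2 * pi * x 0 0) + cos (2 * pi * x 1 0) = 2.
Proof.
split=> [/latticeP h|h]; first by rewrite !cos2pi_int.
have := cos_le1 (2 * pi * x 0 0); have := cos_le1 (2 * pi * x 1 0) => h0 h1.
by apply/latticeP; apply: ord2P; apply: cos2pi_eq1; lra.
Qed.

Lemma open_nonlattice : open [set x : 'cV[R]_2 | to_torus x <> 0].
Proof.
have -> : [set x : 'cV[R]_2 | to_torus x <> 0] =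
    (fun x : 'cV[R]_2 => cos (2 * pi * x 0 0) + cos (2 * pi * x 1 0)) @^-1`
      [set y | y != 2].
  apply/seteqP; split=> x /=.
    by move=> h; apply/eqP => /lattice_cos /to_torus_eq0.
  by move=> /eqP h /to_torus_eq0 /lattice_cos.
apply: open_comp; last exact: open_neq.
have C i : continuous (fun x : 'cV[R]_2 => cos (2 * pi * x i 0)).
  move=> x; apply: (@continuous_comp _ _ _ (fun x : 'cV[R]_2 => x i 0)
    (fun u => cos (2 * pi * u))); first exact: coord_cvg.
  by apply: (@continuous_comp _ _ _ ( *%R (2 * pi)) cos);
    [exact: mulrl_continuous|exact: continuous_cos].
by move=> x _; exact: (cvgD (C 0 x) (C 1 x)).
Qed.

End Lattice.

(** * Plane waves on the torus *)

Section Lines.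
Variables (R : realType) (V : normedModType R).
Implicit Types (f : V -> R) (x v : V).

(** Turns directional derivatives into derivatives on the real line, where the
    chain rule and the mean value theorem are available. *)
Lemma derive_line f x v : 'D_v f x = 'D_1 (fun t : R => f (t *: v + x)) 0.
Proof.
rewrite /derive (_ : (fun h : R => h^-1 *: ((f \o shift x) (h *: v) - f x)) =
  (fun h => h^-1 *: (((fun t : R => f (t *: v + x)) \o shift 0) (h *: 1)
                     - f (0 *: v + x)))) //.
by apply/funext => h /=; rewrite scale0r add0r addr0 -[h *: 1]/(h * 1) mulr1.
Qed.

Lemma is_derive_line f x v d :
  is_derive x v f d <-> is_derive (0 : R) 1 (fun t : R => f (t *: v + x)) d.
Proof.
split=> -[h1 h2]; split.
- exact: (derivable1P f x v).1 h1.
- by rewrite -derive_line.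
- exact: (derivable1P f x v).2 h1.
- by rewrite derive_line.
Qed.

End Lines.

Section Wave.
Variable R : realType.
Implicit Types (m n : int) (p x y : R).

Definition wave m n p x y := cos (2 * pi * (m%:~R * x + n%:~R * y) + p).

(** The same wave on column vectors, the form in which test functions on the
    torus are given. *)
Definition wavev m n p (v : 'cV[R]_2) := wave m n p (v 0 0) (v 1 0).

Lemma wavev_periodic m n p v u : u \in lattice R ->
  wavev m n p (v + u) = wavev m n p v.
Proof.
move=> /latticeP uZ; have /intrP[a ua] := uZ 0; have /intrP[b ub] := uZ 1.
rewrite /wavev /wave !mxE ua ub.
set th := m%:~R * v 0 0 + n%:~R * v 1 0 + p / (2 * pi).
have pE : 2 * pi * (p / (2 * pi)) = p.
  by rewrite mulrC divfK // mulf_neq0 // gt_eqF ?pi_gt0.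
have -> : 2 * pi * (m%:~R * v 0 0 + n%:~R * v 1 0) + p = 2 * pi * th.
  by rewrite -[X in _ + X]pE -mulrDr.
have -> : 2 * pi * (m%:~R * (v 0 0 + a%:~R) + n%:~R * (v 1 0 + b%:~R)) + p
  = 2 * pi * (th + (m * a + n * b)%:~R).
  rewrite -[X in _ + X]pE -mulrDr rmorphD !rmorphM /= /th; congr (_ * _); ring.
by rewrite cos2piDint.
Qed.

Lemma differentiable_wavev c m n p v :
  differentiable (fun u => c * wavev m n p u) v.
Proof.
have D i (u : 'cV[R]_2) : differentiable (fun v : 'cV[R]_2 => v i 0) u.
  exact: differentiable_coord.
apply: (@differentiableM _ _ (cst c)); first exact: differentiable_cst.
apply: (@differentiable_comp _ _ _ _
  (fun u : 'cV[R]_2 => 2 * pi * (m%:~R * u 0 0 + n%:~R * u 1 0) + p) cos).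
  apply: differentiableD; last exact: differentiable_cst.
  apply: (@differentiableM _ _ (cst (2 * pi))); first exact: differentiable_cst.
  apply: differentiableD; apply: (@differentiableM _ _ (cst (_ : R)));
    by [exact: differentiable_cst|exact: D].
by apply/derivable1_diffP; case: (is_derive_cos
  (2 * pi * (m%:~R * v 0 0 + n%:~R * v 1 0) + p)).
Qed.

Definition freq m n (i : 'I_2) : R := (if i == 0 then m else n)%:~R.

(** A phase shift by pi / 2 stands for the passage from cos to - sin, so the
    multiples of waves of given frequency are stable under differentiation. *)
Lemma partial_wavev i c m n p :
  partial i (fun v => c * wavev m n p v) =
  (fun v => c * (2 * pi * freq m n i) * wavev m n (p + pi / 2) v).
Proof.
apply/funext => v; rewrite /partial derive_line /wavev /wave.
set th := 2 * pi * (m%:~R * v 0 0 + n%:~R * v 1 0) + p.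
have -> : (fun t : R => c * cos (2 * pi * (m%:~R * (t *: delta_mx i 0 + v) 0 0
      + n%:~R * (t *: delta_mx i 0 + v) 1 0) + p)) =
    (fun t : R => c * cos (2 * pi * freq m n i * t + th)).
  apply/funext => t; rewrite !mxE /th /freq; congr (_ * cos _).
  by move: i; apply: ord2P => /=; ring.
have : is_derive (0 : R) 1 (fun t : R => c * cos (2 * pi * freq m n i * t + th))
   (c * (2 * pi * freq m n i * - sin th)).
  have h : is_derive (0 : R) 1 (fun t : R => 2 * pi * freq m n i * t + th)
      (2 * pi * freq m n i).
    by apply: is_derive_eq; rewrite addr0 [_ *: 1]mulr1.
  have hc := is_derive_cos (2 * pi * freq m n i * 0 + th).
  have := @is_derive1_comp _ cos (fun t => 2 * pi * freq m n i * t + th)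
    0 _ _ hc h.
  rewrite mulr0 add0r => hh.
  have := @is_deriveZ _ _ _ _ c _ _ _ hh.
  by rewrite [_ *: _]mulrC mulrC [_ * (- _)]mulrC.
case=> _ ->; rewrite -[_ + (p + _)]/(_ + (p + pi / 2)) addrA -/th cosDpihalf.
by ring.
Qed.

(** Every iterated partial derivative is again a multiple of a wave, by
    [partial_wavev]. *)
Lemma smooth_wavev m n p (U : set 'cV[R]_2) : smooth_on U (wavev m n p).
Proof.
move=> s x _.
have [c [q ->]] : exists c q, foldr (@partial R) (wavev m n p) s =
    (fun v => c * wavev m n q v).
  elim: s => [|i s [c [q IH]]] /=.
    by exists 1, p; apply/funext => v; rewrite mul1r.
  by rewrite IH partial_wavev; eexists; eexists.
exact: differentiable_wavev.
Qed.

Lemma laplacian_wavev m n p v :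
  laplacian (wavev m n p) v =
  - (4 * pi ^+ 2 * (m%:~R ^+ 2 + n%:~R ^+ 2)) * wavev m n p v.
Proof.
have E : wavev m n p = (fun v => 1 * wavev m n p v).
  by apply/funext => u; rewrite mul1r.
rewrite /laplacian [X in \sum__ partial _ (partial _ X) _]E.
under eq_bigr do rewrite !partial_wavev.
have -> : wavev m n (p + pi / 2 + pi / 2) v = - wavev m n p v.
  rewrite /wavev /wave -[p + _ + _]addrA.
  rewrite (_ : pi / 2 + pi / 2 = pi); last by field.
  by rewrite addrA cosDpi.
by rewrite !big_ord_recl big_ord0 /freq /=; ring.
Qed.

Lemma measurable_wave m n p :
  measurable_fun setT (fun z : measurableTypeR R * measurableTypeR R =>
    wave m n p z.1 z.2).
Proof.
apply: measurableT_comp.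
  exact: continuous_measurable_fun (@continuous_cos R).
apply: measurable_funD => //; apply: measurable_funM => //.
by apply: measurable_funD; apply: measurable_funM.
Qed.

End Wave.

(** * Integration over the unit square *)

Section Square.
Variable R : realType.
Local Notation RR := (measurableTypeR R * measurableTypeR R)%type.
Local Notation mu := (@area R).
Local Notation US := (@unit_square R).

Lemma measurable_square : measurable US.
Proof. by apply: measurableX; exact: measurable_itv. Qed.

Lemma area_rect (a b c d : R) : a <= b -> c <= d ->
  mu (`[a, b[ `*` `[c, d[) = ((b - a) * (d - c))%:E.
Proof.
move=> ab cd; rewrite /area product_measure1E; try exact: measurable_itv.
rewrite /= !lebesgue_measure_itv /= !lte_fin EFinM.
by congr (_ * _)%E; case: ltgtP ab cd => //= -> _; rewrite ?subrr //;
  case: ltgtP => // ->; rewrite subrr.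
Qed.

Lemma area_square : mu US = 1%E.
Proof. by rewrite area_rect ?ler01 // subr0 mulr1. Qed.

Lemma integrable_bounded_square (g : RR -> R) (M : R) :
  measurable_fun setT g -> (forall z, `|g z| <= M) ->
  mu.-integrable US (EFin \o g).
Proof.
move=> mg bg; apply: measurable_bounded_integrable.
- exact: measurable_square.
- by change (mu US < +oo)%E; rewrite area_square ltry.
- exact: measurable_funTS.
- exists M; split; first exact: num_real.
  by move=> x Mx z _; apply: le_trans (bg z) (ltW Mx).
Qed.

Lemma integrable_mul_square (f g : RR -> R) (M : R) :
  mu.-integrable US (EFin \o f) ->
  measurable_fun setT g -> (forall z, `|g z| <= M) ->
  mu.-integrable US (EFin \o (fun z => f z * g z)).
Proof.
move=> fi mg bg.
have := @integrableMl _ _ _ mu _ measurable_square _ g fi (measurable_funTS mg).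
apply; exists M; split; first exact: num_real.
by move=> x Mx z _; apply: le_trans (bg z) (ltW Mx).
Qed.

(** The primitive sin (k y + p) / k takes the same value at 0 and 1. *)
Lemma integral_cos_period (n : int) (p : R) : n != 0 ->
  (\int[lebesgue_measure]_(y in `[0%R, 1%R[)
     (cos (2 * pi * (n%:~R * y) + p))%:E = 0)%E.
Proof.
move=> n0.
have k0 : 2 * pi * n%:~R != 0 :> R.
  by rewrite !mulf_neq0 ?intr_eq0 // gt_eqF ?pi_gt0.
set k := 2 * pi * n%:~R in k0.
have E y : 2 * pi * (n%:~R * y) = k * y by rewrite /k; ring.
under eq_integral do rewrite E.
have D (x : R) :
    is_derive x 1 (fun y => k^-1 * sin (k * y + p)) (cos (k * x + p)).
  have h : is_derive x 1 (fun t : R => k * t + p) k.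
    by apply: is_derive_eq; rewrite addr0 [_ *: 1]mulr1.
  have hs := is_derive_sin (k * x + p).
  have hh := @is_derive1_comp _ sin (fun t => k * t + p) x _ _ hs h.
  have := @is_deriveZ _ _ _ _ k^-1 _ _ _ hh.
  by rewrite [_ *: _]mulrC mulfK.
have C : continuous (fun y : R => cos (k * y + p)).
  move=> x; apply: (@continuous_comp _ _ _ (fun t : R => k * t + p) cos).
    apply: differentiable_continuous; apply/derivable1_diffP.
    by apply: derivableD.
  exact: continuous_cos.
have C' : continuous (fun y : R => k^-1 * sin (k * y + p)).
  move=> x; apply: differentiable_continuous; apply/derivable1_diffP.
  exact: ex_derive.
rewrite integral_itv_bndo_bndc; last first.
  apply/measurable_EFinP; apply: measurable_funTS.
  exact: continuous_measurable_fun.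
rewrite (@continuous_FTC2 _ _ (fun y : R => k^-1 * sin (k * y + p))) //.
- rewrite mulr0 mulr1 -EFinB.
  have -> : sin (k + p) = sin (0 + p).
    have : cos (2 * pi * ((p - pi / 2) / (2 * pi) + n%:~R)) =
           cos (2 * pi * ((p - pi / 2) / (2 * pi))) by exact: cos2piDint.
    rewrite mulrDr -/k mulrC divfK ?mulf_neq0 ?gt_eqF ?pi_gt0 //.
    by rewrite addrAC cosBpihalf cosBpihalf addrC add0r.
  by rewrite subrr.
- by apply: continuous_subspaceT.
- split=> [x _||].
  + exact: ex_derive.
  + by apply: cvg_at_right_filter; exact: C'.
  + by apply: cvg_at_left_filter; exact: C'.
- by move=> x _; rewrite derive1E derive_val.
Qed.

End Square.

Section Integrals.
Variable R : realType.
Local Notation RR := (measurableTypeR R * measurableTypeR R)%type.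
Local Notation mu := (@area R).
Local Notation US := (@unit_square R).
Implicit Types (m n : int) (p c : R).

Lemma wave_le1 m n p (z : RR) : `|wave m n p z.1 z.2| <= 1.
Proof. by rewrite ler_norml cos_geN1 cos_le1. Qed.

Lemma integrable_wave m n p :
  mu.-integrable US (EFin \o (fun z : RR => wave m n p z.1 z.2)).
Proof.
by apply: (@integrable_bounded_square _ _ 1);
  [exact: measurable_wave|exact: wave_le1].
Qed.

(** Fubini, integrating first in a variable of nonzero frequency. *)
Lemma integral_wave m n p : (m != 0) || (n != 0) ->
  \int[mu]_(z in US) wave m n p z.1 z.2 = 0.
Proof.
move=> mn0; rewrite /Rintegral integral_mkcond.
set f := (X in (\int[_]_x (X x))%E).
have fE x y : f (x, y) =
    (if (x \in `[0%R, 1%R[%classic) && (y \in `[0%R, 1%R[%classic)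
     then (wave m n p x y)%:E else 0)%E.
  rewrite /f patchE /unit_square /=.
  by rewrite in_setX /=; case: (_ && _).
have fi : (@area R).-integrable setT f.
  have := integrable_wave m n p.
  by move/(integrable_mkcond _ (@measurable_square R)).
have [n0|n0] := eqVneq n 0; last first.
  rewrite -integral12_prod_meas1 //; rewrite integral0_eq // => x _.
  transitivity (\int[lebesgue_measure]_y
      (if (x \in `[0%R, 1%R[%classic) && (y \in `[0%R, 1%R[%classic)
       then (wave m n p x y)%:E else 0))%E.
    by apply: eq_integral => y _; exact: fE.
  case: (x \in _) => /=; last by rewrite integral0.
  apply: etrans (@integral_cos_period _ n (p + 2 * pi * (m%:~R * x)) n0).
  rewrite [RHS]integral_mkcond; apply: eq_integral => y _.
  by rewrite patchE /wave; case: ifP => // _; congr (cos _)%:E; ring.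
have m0 : m != 0 by move: mn0; rewrite n0 eqxx orbF.
rewrite -integral21_prod_meas1 //; rewrite integral0_eq // => y _.
transitivity (\int[lebesgue_measure]_x
    (if (y \in `[0%R, 1%R[%classic) && (x \in `[0%R, 1%R[%classic)
     then (wave m n p x y)%:E else 0))%E.
  by apply: eq_integral => x _; rewrite andbC; exact: fE.
case: (y \in _) => /=; last by rewrite integral0.
apply: etrans (@integral_cos_period _ m (p + 2 * pi * (n%:~R * y)) m0).
rewrite [RHS]integral_mkcond; apply: eq_integral => x _.
by rewrite patchE /wave; case: ifP => // _; congr (cos _)%:E; ring.
Qed.

End Integrals.

(** * Peaks: trigonometric kernels and their pairing with a function *)

Section Peak.
Variable R : realType.
Local Notation RR := (measurableTypeR R * measurableTypeR R)%type.
Local Notation mu := (@area R).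
Local Notation US := (@unit_square R).
Implicit Types (m n : int) (p c : R) (f g h : RR -> R).

(** The product-to-sum formula: products of waves are combinations of waves. *)
Lemma waveM m n p m' n' p' x y :
  wave m n p x y * wave m' n' p' x y =
  2^-1 * (wave (m + m') (n + n') (p + p') x y
          + wave (m - m') (n - n') (p - p') x y) :> R.
Proof.
rewrite /wave; set A := 2 * pi * (m%:~R * x + n%:~R * y) + p.
set B := 2 * pi * (m'%:~R * x + n'%:~R * y) + p'.
have -> : 2 * pi * ((m + m')%:~R * x + (n + n')%:~R * y) + (p + p') = A + B.
  by rewrite !rmorphD /= /A /B; ring.
have -> : 2 * pi * ((m - m')%:~R * x + (n - n')%:~R * y) + (p - p') = A - B.
  by rewrite !rmorphB /= /A /B; ring.
rewrite (cosD A B) (cosB A B).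
by move: (cos A) (cos B) (sin A) (sin B) => *; field.
Qed.

(** Up to normalization, 2 + cos (2 pi (s x - a)) + cos (2 pi (t y - b)). For
    s = t = 1 it peaks at (a, b) modulo Z^2; the signs s and t are built in so
    that one product formula, [peak_wave], serves a peak and its reflection. *)
Definition peak (s t : int) (a b x y : R) : R :=
  (2 + wave s 0 (- (2 * pi * a)) x y + wave 0 t (- (2 * pi * b)) x y) / 4.

Lemma peakE (s t : int) a b x y : peak s t a b x y =
  (2 + cos (2 * pi * (s%:~R * x - a)) + cos (2 * pi * (t%:~R * y - b))) / 4
  :> R.
Proof. by rewrite /peak /wave; congr ((_ + cos _ + cos _) / _); ring. Qed.

(** The coefficients and phases on the right do not depend on s and t, which is
    what carries a symmetry of the moments through the powers of a peak. *)
Lemma peak_wave s t a b m n p x y :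
  peak s t a b x y * wave (s * m) (t * n) p x y =
    2^-1 * wave (s * m) (t * n) p x y
    + (8^-1 * wave (s * (m + 1)) (t * n) (p - 2 * pi * a) x y
    + (8^-1 * wave (s * (m - 1)) (t * n) (p + 2 * pi * a) x y
    + (8^-1 * wave (s * m) (t * (n + 1)) (p - 2 * pi * b) x y
    + (8^-1 * wave (s * m) (t * (n - 1)) (p + 2 * pi * b) x y)))).
Proof.
have E1 := waveM (s * m) (t * n) p s 0 (- (2 * pi * a)) x y.
have E2 := waveM (s * m) (t * n) p 0 t (- (2 * pi * b)) x y.
rewrite ?subr0 ?addr0 ?subr0 ?opprK in E1 E2.
rewrite !(mulrDr s) !(mulrDr t) !mulr1 !mulrN1.
have -> : peak s t a b x y * wave (s * m) (t * n) p x y =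
  2^-1 * wave (s * m) (t * n) p x y
  + 4^-1 * (wave (s * m) (t * n) p x y * wave s 0 (- (2 * pi * a)) x y)
  + 4^-1 * (wave (s * m) (t * n) p x y * wave 0 t (- (2 * pi * b)) x y).
  by rewrite /peak; field.
by rewrite E1 E2; field.
Qed.

Lemma peak01 s t a b x y : 0 <= peak s t a b x y <= 1.
Proof.
rewrite /peak /wave.
set A := (X in 2 + cos X + _); set B := (X in 2 + _ + cos X).
have := cos_le1 A; have := cos_geN1 A; have := cos_le1 B; have := cos_geN1 B.
by move=> *; apply/andP; split; lra.
Qed.

(** The class of multipliers for which the pairing with an integrable function
    is finite and linear. *)
Definition bounded_meas g :=
  measurable_fun setT g /\ exists M, forall z, `|g z| <= M.

Lemma bounded_meas_wave m n p : bounded_meas (fun z : RR => wave m n p z.1 z.2).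
Proof. by split; [exact: measurable_wave|exists 1; exact: wave_le1]. Qed.

Lemma bounded_measM g h :
  bounded_meas g -> bounded_meas h -> bounded_meas (fun z => g z * h z).
Proof.
move=> [mg [M gM]] [mh [N hN]]; split; first exact: measurable_funM.
by exists (M * N) => z; rewrite normrM ler_pM.
Qed.

Lemma bounded_meas_peakX s t a b N :
  bounded_meas (fun z : RR => peak s t a b z.1 z.2 ^+ N).
Proof.
split; last first.
  exists 1 => z; have /andP[h0 h1] := peak01 s t a b z.1 z.2.
  by rewrite ger0_norm ?exprn_ge0 // exprn_ile1.
apply: measurable_funX; apply: measurable_funM => //.
by apply: measurable_funD; [apply: measurable_funD => //|];
  exact: measurable_wave.
Qed.

Lemma bounded_measD g h :
  bounded_meas g -> bounded_meas h -> bounded_meas (fun z => g z + h z).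
Proof.
move=> [mg [M gM]] [mh [N hN]]; split; first exact: measurable_funD.
by exists (M + N) => z; rewrite (le_trans (ler_normD _ _)) ?lerD.
Qed.

Lemma bounded_measZ c g : bounded_meas g -> bounded_meas (fun z => c * g z).
Proof.
move=> [mg [M gM]]; split; first exact: measurable_funM.
by exists (`|c| * M) => z; rewrite normrM ler_wpM2l.
Qed.

Definition pair_int f g := \int[mu]_(z in US) (f z * g z).

Section Pairing.
Variable f : RR -> R.
Hypothesis fi : mu.-integrable US (EFin \o f).

Lemma integrable_pair g : bounded_meas g ->
  mu.-integrable US (EFin \o (fun z => f z * g z)).
Proof. by move=> [mg [M gM]]; exact: (integrable_mul_square fi mg gM). Qed.

Lemma eq_pair_int g h : (forall z, g z = h z) -> pair_int f g = pair_int f h.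
Proof. by move=> gh; congr pair_int; apply/funext. Qed.

Lemma pair_intZD c g h : bounded_meas g -> bounded_meas h ->
  pair_int f (fun z => c * g z + h z) = c * pair_int f g + pair_int f h.
Proof.
move=> bg bh; rewrite /pair_int.
have mU := @measurable_square R.
rewrite -(RintegralZl c mU (integrable_pair bg)).
rewrite -(RintegralD mU _ (integrable_pair bh)); last first.
  have := integrable_pair (bounded_measZ c bg); congr (_.-integrable _ _).
  by apply/funext => z /=; rewrite mulrCA.
by apply: eq_Rintegral => z _; ring.
Qed.

Lemma pair_intZ c g : bounded_meas g ->
  pair_int f (fun z => c * g z) = c * pair_int f g.
Proof.
move=> bg; rewrite /pair_int.
rewrite -(RintegralZl c (@measurable_square R) (integrable_pair bg)).
by apply: eq_Rintegral => z _; ring.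
Qed.

(** Equality of moments on all waves extends to powers of a peak, by expanding
    one factor at a time with [peak_wave]. *)
Lemma pair_int_peakX s t a b :
  (forall m n p, pair_int f (fun z => wave m n p z.1 z.2) =
                 pair_int f (fun z => wave (s * m) (t * n) p z.1 z.2)) ->
  forall N m n p,
  pair_int f (fun z => peak 1 1 a b z.1 z.2 ^+ N * wave m n p z.1 z.2) =
  pair_int f (fun z => peak s t a b z.1 z.2 ^+ N
                       * wave (s * m) (t * n) p z.1 z.2).
Proof.
move=> sym; elim=> [|N IH] m n p.
  transitivity (pair_int f (fun z => wave m n p z.1 z.2)).
    by apply: eq_pair_int => z; rewrite expr0 mul1r.
  by rewrite sym; apply: eq_pair_int => z; rewrite expr0 mul1r.
pose T s' t' m' n' p' := (fun z : RR => peak s' t' a b z.1 z.2 ^+ N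
                       * wave (s' * m') (t' * n') p' z.1 z.2).
have bT s' t' m' n' p' : bounded_meas (T s' t' m' n' p').
  by apply: bounded_measM; [exact: bounded_meas_peakX|exact: bounded_meas_wave].
have step s' t' :
    pair_int f (fun z => peak s' t' a b z.1 z.2 ^+ N.+1
                         * wave (s' * m) (t' * n) p z.1 z.2) =
    2^-1 * pair_int f (T s' t' m n p)
    + (8^-1 * pair_int f (T s' t' (m + 1) n (p - 2 * pi * a))
    + (8^-1 * pair_int f (T s' t' (m - 1) n (p + 2 * pi * a))
    + (8^-1 * pair_int f (T s' t' m (n + 1) (p - 2 * pi * b))
    + 8^-1 * pair_int f (T s' t' m (n - 1) (p + 2 * pi * b))))).
  rewrite -[8^-1 * pair_int f (T s' t' m (n - 1) _)]pair_intZ //.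
  have b1 := bounded_measZ 8^-1 (bT s' t' m (n - 1) (p + 2 * pi * b)).
  have b2 := bounded_measD
    (bounded_measZ 8^-1 (bT s' t' m (n + 1) (p - 2 * pi * b))) b1.
  have b3 := bounded_measD
    (bounded_measZ 8^-1 (bT s' t' (m - 1) n (p + 2 * pi * a))) b2.
  have b4 := bounded_measD
    (bounded_measZ 8^-1 (bT s' t' (m + 1) n (p - 2 * pi * a))) b3.
  rewrite -(pair_intZD 8^-1 _ b1) // -(pair_intZD 8^-1 _ b2) //.
  rewrite -(pair_intZD 8^-1 _ b3) // -(pair_intZD 2^-1 _ b4) //.
  apply: eq_pair_int => z; rewrite exprSr -mulrA peak_wave /T; ring.
have E m' n' p' : pair_int f (T 1 1 m' n' p') = pair_int f (T s t m' n' p').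
  by rewrite -IH; apply: eq_pair_int => z; rewrite /T !mul1r.
by rewrite step -!E -step; apply: eq_pair_int => z; rewrite !mul1r.
Qed.

End Pairing.

End Peak.

(** * Concentration of powers of a peak *)

Section Concentration.
Variable R : realType.
Local Notation RR := (measurableTypeR R * measurableTypeR R)%type.
Local Notation mu := (@area R).
Local Notation US := (@unit_square R).

(** Bernoulli inequality. *)
Lemma expr_unbounded (r A : R) : 1 < r ->
  exists N0, forall N, (N0 <= N)%N -> A < r ^+ N.
Proof.
move=> r1; have r0 : 0 < r - 1 by rewrite subr_gt0.
exists (Num.truncn (`|A| / (r - 1))).+1 => N hN.
have bern : 1 + N%:R * (r - 1) <= r ^+ N.
  elim: N {hN} => [|N IH]; first by rewrite mul0r addr0 expr0.
  rewrite exprS -natr1 mulrDl mul1r.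
  have : 0 <= N%:R * (r - 1) by rewrite mulr_ge0 ?ler0n ?ltW.
  by move: (N%:R * (r - 1)) IH => u IH u0; nra.
apply: lt_le_trans bern; apply: (le_lt_trans (ler_norm A)).
have h : `|A| / (r - 1) < N%:R.
  apply: (lt_le_trans (truncnS_gt _)); by rewrite ler_nat.
by rewrite ltr_pdivrMr // in h; lra.
Qed.

Lemma cos2pi_near (e : R) : e < 1 ->
  exists2 s, 0 < s & forall t, `|t| < s -> e < cos (2 * pi * t).
Proof.
move=> e1.
have C : (fun t : R => cos (2 * pi * t)) @ (0 : R) --> cos (2 * pi * 0 : R).
  by apply: (@continuous_comp _ _ _ ( *%R (2 * pi)) cos);
    [exact: mulrl_continuous|exact: continuous_cos].
have : \forall t \near (0 : R), e < cos (2 * pi * t).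
  by apply: (cvgr_gt _ C); rewrite mulr0 cos0.
move=> /nbhs_ballP[s /= s0 h]; exists s => // t ts.
by apply: h; rewrite /ball /= sub0r normrN.
Qed.

Lemma peak11E a b x y : peak 1 1 a b x y =
  (2 + cos (2 * pi * (x - a)) + cos (2 * pi * (y - b))) / 4 :> R.
Proof. by rewrite peakE !mul1r. Qed.

(** Split the square according to the value B of the peak: on the box V next to
    (a, b), B > th' and f is at least eps; where B > th, f is nonnegative; and
    elsewhere B^N is at most th^N. Hence f B^N dominates
    eps th'^N 1_V - th^N |f| pointwise, and th < th' makes the integral of this
    minorant positive for large N. *)
Lemma peak_concentration (f : RR -> R) (a b d eps : R) :
  mu.-integrable US (EFin \o f) ->
  0 <= a < 1 -> 0 <= b < 1 -> 0 < d -> 0 < eps ->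
  (forall (m n : int) x y,
     `|x - a - m%:~R| < d -> `|y - b - n%:~R| < d -> eps <= f (x, y)) ->
  exists N0, forall N, (N0 <= N)%N ->
    0 < pair_int f (fun z => peak 1 1 a b z.1 z.2 ^+ N).
Proof.
move=> fi /andP[a0 a1] /andP[b0 b1] d0 eps0 fd.
(* de < 1/2 keeps 2 pi de in the range where the cosine is injective *)
pose de := Num.min d 4^-1.
have de0 : 0 < de by rewrite /de lt_min d0 invr_gt0 ltr0n.
have de1 : de < 2^-1 by rewrite /de gt_min; apply/orP; right; lra.
have ded : de <= d by rewrite /de ge_min lexx.
pose ka := cos (2 * pi * de).
have ka1 : ka < 1.
  rewrite /ka -[ltRHS]cos0 ltr_cos ?mulr_gt0 ?pi_gt0 //
    in_itv /= ?lexx ?pi_ge0 //.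
  by have := pi_gt0 R; move=> p0; apply/andP; split; nra.
have kaN : -1 <= ka by exact: cos_geN1.
(* if the peak exceeds (3 + ka) / 4, each of its two cosines exceeds ka *)
pose th := (3 + ka) / 4; pose th' := (1 + th) / 2.
have th0 : 0 < th by rewrite /th; lra.
have th1 : th < th' by rewrite /th' /th; lra.
have th'1 : th' < 1 by rewrite /th' /th; lra.
have [s0 s00 hs0] := @cos2pi_near (2 * th' - 1) ltac:(lra).
(* the box of side s at (a, b) must stay inside the half-open unit square *)
pose s := Num.min s0 (Num.min (1 - a) (1 - b)).
have s_gt0 : 0 < s by rewrite /s !lt_min s00 !subr_gt0 a1 b1.
have ss0 : s <= s0 by rewrite /s ge_min lexx.
have sa : s <= 1 - a by rewrite /s !ge_min lexx /= orbT.
have sb : s <= 1 - b by rewrite /s !ge_min lexx !orbT.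
pose V : set RR := `[a, a + s[ `*` `[b, b + s[.
have mV : measurable V by apply: measurableX; exact: measurable_itv.
have VU : V `<=` US.
  move=> [x y] [] /=; rewrite !in_itv /= => /andP[x0 x1] /andP[y0 y1].
  by split; rewrite /= in_itv /=; apply/andP; split; lra.
have far z : th < peak 1 1 a b z.1 z.2 -> eps <= f z.
  rewrite peak11E => h; case: z h => x y /= h.
  have c1 := cos_le1 (2 * pi * (x - a)); have c2 := cos_le1 (2 * pi * (y - b)).
  have [|m hm] := @cos2pi_gt _ (x - a) _ de0 de1.
    by rewrite -/ka; move: h; rewrite /th; lra.
  have [|n hn] := @cos2pi_gt _ (y - b) _ de0 de1.
    by rewrite -/ka; move: h; rewrite /th; lra.
  by apply: (fd m n); [apply: lt_le_trans hm ded|apply: lt_le_trans hn ded].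
have inV z : V z -> th' < peak 1 1 a b z.1 z.2.
  case: z => x y [] /=; rewrite !in_itv /= => /andP[x0 x1] /andP[y0 y1].
  rewrite peak11E.
  have hx : 2 * th' - 1 < cos (2 * pi * (x - a)).
    by apply: hs0; rewrite ger0_norm; lra.
  have hy : 2 * th' - 1 < cos (2 * pi * (y - b)).
    by apply: hs0; rewrite ger0_norm; lra.
  by lra.
have ptw N z : US z -> eps * th' ^+ N * \1_V z - th ^+ N * `|f z| <=
    f z * peak 1 1 a b z.1 z.2 ^+ N.
  move=> _; have /andP[B0 _] := peak01 1 1 a b z.1 z.2.
  have thN : 0 <= th ^+ N * `|f z| by rewrite mulr_ge0 // exprn_ge0 // ltW.
  rewrite indicE; case: (boolP (z \in V)) => [/set_mem zV|_] /=; last first.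
    rewrite mulr0 sub0r.
    have [Bth|Bth] := leP (peak 1 1 a b z.1 z.2) th.
      have : `|f z * peak 1 1 a b z.1 z.2 ^+ N| <= th ^+ N * `|f z|.
        rewrite normrM mulrC ler_wpM2r // normrX ger0_norm //.
        by rewrite lerXn2r ?nnegrE ?(ltW th0).
      by rewrite ler_norml => /andP[].
    apply: (@le_trans _ _ 0); first by rewrite oppr_le0.
    by rewrite mulr_ge0 ?exprn_ge0 // (le_trans _ (far _ Bth)) // ltW.
  rewrite mulr1; have h := inV _ zV.
  have h2 := far _ (lt_trans th1 h).
  apply: (@le_trans _ _ (eps * th' ^+ N)); first by rewrite gerBl.
  rewrite ler_pM ?exprn_ge0 ?(ltW eps0) //;
    try by apply: ltW; apply: lt_trans th1.
  by rewrite lerXn2r ?nnegrE ?(ltW h) //; apply: ltW; apply: lt_trans th1.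
pose A := \int[mu]_(z in US) `|f z|.
have A0 : 0 <= A by apply: Rintegral_ge0 => z _; exact: normr_ge0.
have q1 : 1 < th' / th by rewrite ltr_pdivlMr // mul1r.
have [N0 hN0] := expr_unbounded (A / (eps * s ^+ 2)) q1.
exists N0 => N /hN0 hN.
have mU := @measurable_square R.
have i1 : mu.-integrable US (EFin \o (fun z => eps * th' ^+ N * \1_V z)).
  apply: (@integrable_bounded_square _ _ (`|eps * th' ^+ N|)).
    by apply: measurable_funM => //; exact: measurable_indic.
  move=> z; rewrite normrM indicE; case: (_ \in _); rewrite ?normr1 ?mulr1 //.
  by rewrite normr0 mulr0.
have i2 : mu.-integrable US (EFin \o (fun z => th ^+ N * `|f z|)).
  have := @integrable_norm _ _ _ mu US f fi.
  by move=> /(integrableZl mU (th ^+ N)).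
have i3 : mu.-integrable US
    (EFin \o (fun z => f z * peak 1 1 a b z.1 z.2 ^+ N)).
  by apply: integrable_pair => //; exact: bounded_meas_peakX.
have i12 : mu.-integrable US
    (EFin \o (fun z => eps * th' ^+ N * \1_V z - th ^+ N * `|f z|)).
  have := @integrableB _ _ _ mu US mU _ _ i1 i2.
  by congr (_.-integrable _ _).
apply: lt_le_trans (le_Rintegral mU i12 i3 (ptw N)).
rewrite (RintegralB mU i1 i2).
rewrite (RintegralZl _ mU (integrable_norm fi)) -/A.
have -> : \int[mu]_(z in US) (eps * th' ^+ N * \1_V z) =
    eps * th' ^+ N * s ^+ 2.
  rewrite RintegralZl //; last first.
    apply: (@integrable_bounded_square _ _ 1); first exact: measurable_indic.
    move=> z; rewrite indicE.
    by case: (_ \in _); rewrite ?normr1 ?normr0 ?ler01.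
  congr (_ * _); rewrite /Rintegral integral_indic // setIidl //.
  have := @area_rect R a (a + s) b (b + s).
  rewrite !lerDl => /(_ (ltW s_gt0) (ltW s_gt0)).
  have E x : x + s - x = s by rewrite addrAC subrr add0r.
  rewrite !E -expr2 => VE.
  by change (fine (mu V) = s ^+ 2); rewrite VE.
rewrite subr_gt0.
have es : 0 < eps * s ^+ 2 by rewrite mulr_gt0 // exprn_gt0.
rewrite ltr_pdivrMr // expr_div_n mulrAC ltr_pdivlMr ?exprn_gt0 // in hN.
by rewrite mulrC (_ : eps * _ * _ = th' ^+ N * (eps * s ^+ 2)) //; ring.
Qed.

End Concentration.

(** * The Green function is invariant under reflections *)

Section Symmetry.
Variable R : realType.
Local Notation RR := (measurableTypeR R * measurableTypeR R)%type.
Local Notation mu := (@area R).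
Local Notation US := (@unit_square R).
Variable F : torus R -> R.
Hypothesis gF : is_green F.
Local Notation Fl := (F \o @to_torus R).
Local Notation Fs := (on_square Fl).

(** For a nonzero frequency this is the equation of F tested on the wave, whose
    value at 0 is cos p and whose mean is 0. For m = n = 0 it says that F has
    mean 0, the right-hand side being 0 since the inverse of 0 is 0. *)
Lemma green_wave m n p :
  pair_int Fs (fun z => wave m n p z.1 z.2) =
  - cos p / (2 * pi * (m%:~R ^+ 2 + n%:~R ^+ 2)).
Proof.
have p0 := pi_gt0 R.
have [mn0|mn0] := boolP ((m != 0) || (n != 0)); last first.
  move: mn0; rewrite negb_or !negbK => /andP[/eqP -> /eqP ->].
  rewrite !expr0n /= addr0 mulr0 invr0 mulr0.
  transitivity (cos p * torus_int Fl).
    have mU := @measurable_square R.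
    rewrite /torus_int -(RintegralZl _ mU (green_integrable gF)).
    by apply: eq_Rintegral => z _; rewrite /wave !mul0r addr0 mulr0 add0r mulrC.
  by rewrite (green_mean gF) mulr0.
have k0 : 0 < m%:~R ^+ 2 + n%:~R ^+ 2 :> R.
  have sq (k : int) : k != 0 -> 0 < k%:~R ^+ 2 :> R.
    by move=> k0; rewrite exprn_even_gt0 //= intr_eq0.
  have sq0 (k : int) : 0 <= k%:~R ^+ 2 :> R by rewrite sqr_ge0.
  case/orP: mn0 => /sq h; [have := sq0 n|have := sq0 m]; lra.
have [g gE] := torus_factor (wavev_periodic m n p).
have gs : smooth_on setT (g \o @to_torus R).
  by rewrite gE; exact: smooth_wavev.
have := green_eq gF gs; rewrite gE.
have -> : g 0 = cos p.
  have := congr1 (fun f => f 0) gE; rewrite /= to_torus0 => ->.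
  by rewrite /wavev /wave !mxE !mulr0 addr0 mulr0 add0r.
have -> : torus_int (wavev m n p) = 0.
  rewrite -(integral_wave p mn0); apply: eq_Rintegral => z _.
  by rewrite /on_square /wavev vec2E0 vec2E1.
set K := m%:~R ^+ 2 + n%:~R ^+ 2 in k0 *.
rewrite subr0 => E.
have : - (4 * pi ^+ 2 * K) * pair_int Fs (fun z => wave m n p z.1 z.2) =
    2 * pi * cos p.
  rewrite -E -(pair_intZ (green_integrable gF)); last exact: bounded_meas_wave.
  apply: eq_Rintegral => z _; rewrite /on_square /= laplacian_wavev.
  by rewrite /wavev vec2E0 vec2E1.
have pn : pi != 0 :> R by rewrite gt_eqF.
have Kn : K != 0 by rewrite gt_eqF.
move: (pi : R) pn (pair_int _ _) (cos p) => P Pn I c H.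
apply: (@mulfI _ (- (4 * P ^+ 2 * K))).
  by rewrite oppr_eq0 !mulf_neq0 // pnatr_eq0.
rewrite H; field.
by rewrite Pn Kn.
Qed.

Lemma integral_wave_sym (s t : int) m n p : s ^+ 2 = 1 -> t ^+ 2 = 1 ->
  \int[mu]_(z in US) wave m n p z.1 z.2 =
  \int[mu]_(z in US) wave (s * m) (t * n) p z.1 z.2 :> R.
Proof.
move=> s1 t1.
have nz (u : int) : u ^+ 2 = 1 -> u != 0.
  by apply: contra_eq_neq => ->; rewrite expr0n.
have [mn0|mn0] := boolP ((m != 0) || (n != 0)).
  by rewrite !integral_wave // !mulf_eq0 (negbTE (nz s s1)) (negbTE (nz t t1)).
move: mn0; rewrite negb_or !negbK => /andP[/eqP -> /eqP ->].
by rewrite !mulr0.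
Qed.

Lemma integrable_centered c : mu.-integrable US (EFin \o (fun z => Fs z - c)).
Proof.
have ci : mu.-integrable US (EFin \o (fun z : RR => c)).
  by apply: (@integrable_bounded_square _ _ `|c|).
have mU := @measurable_square R.
have := @integrableB _ _ _ mu US mU _ _ (green_integrable gF) ci.
by congr (_.-integrable _ _).
Qed.

(** The constant c only contributes through the mean of the wave, and
    [green_wave] sees only the squares of m and n. *)
Lemma green_moments (s t : int) c m n p : s ^+ 2 = 1 -> t ^+ 2 = 1 ->
  pair_int (fun z => Fs z - c) (fun z => wave m n p z.1 z.2) =
  pair_int (fun z => Fs z - c) (fun z => wave (s * m) (t * n) p z.1 z.2).
Proof.
move=> s1 t1.
have E m' n' : pair_int (fun z => Fs z - c) (fun z => wave m' n' p z.1 z.2) =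
    pair_int Fs (fun z => wave m' n' p z.1 z.2)
    - c * \int[mu]_(z in US) wave m' n' p z.1 z.2.
  have mU := @measurable_square R.
  rewrite -(RintegralZl _ mU (integrable_wave m' n' p)) /pair_int.
  rewrite -RintegralB //.
  - by apply: eq_Rintegral => z _; rewrite mulrBl.
  - apply: integrable_pair; first exact: green_integrable.
    exact: bounded_meas_wave.
  - have := integrableZl mU c (integrable_wave m' n' p).
    by congr (_.-integrable _ _).
rewrite !E -(integral_wave_sym _ _ _ s1 t1) !green_wave.
congr (_ / (_ * _) - _).
by rewrite !rmorphM /= !exprMn -!(rmorphXn intr) s1 t1 /= !mul1r.
Qed.

Let unit_rep (x : R) : exists k : int, 0 <= x - k%:~R < 1.
Proof.
exists (Num.floor x); have /andP[h1 h2] := floor_itv x.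
by rewrite rmorphD /= in h2; apply/andP; split; lra.
Qed.

(** Continuity of F at a point other than 0, in the periodic form demanded by
    [peak_concentration]. The sign covers the cases F > c and F < c. *)
Lemma green_near v c (sg : bool) : to_torus v <> 0 ->
  0 < (-1) ^+ sg * (Fl v - c) ->
  exists d eps, [/\ 0 < d, 0 < eps & forall (m n : int) x y,
     `|x - v 0 0 - m%:~R| < d -> `|y - v 1 0 - n%:~R| < d ->
     eps <= (-1) ^+ sg * (Fs (x, y) - c)].
Proof.
move=> v0 h; set e := (-1) ^+ sg * (Fl v - c) in h.
have Fc : {for v, continuous Fl}.
  exact: differentiable_continuous (green_smooth gF [::] v0).
have C : (fun x => (-1) ^+ sg * (Fl x - c)) @ v --> e.
  apply: (@continuous_comp _ _ _ (fun x => Fl x - c) ( *%R ((-1) ^+ sg))).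
    by apply: continuousB; [exact: Fc|exact: cst_continuous].
  exact: mulrl_continuous.
have : \forall x \near v, e / 2 < (-1) ^+ sg * (Fl x - c).
  by apply: (cvgr_gt _ C); lra.
move=> /nbhs_ballP[d /= d0 hd]; exists d, (e / 2); split=> //; first lra.
move=> m n x y hx hy.
have -> : Fs (x, y) = Fl (vec2 (x - m%:~R) (y - n%:~R)).
  rewrite /on_square /=; congr F; apply/to_torus_eq/latticeP; apply: ord2P;
    by rewrite !mxE /= opprB addrC subrK intr_int.
apply/ltW/hd; split => // i j; rewrite (ord1 j).
move: i; apply: ord2P; rewrite /ball /= mxE /= distrC.
  by rewrite addrAC.
by rewrite addrAC.
Qed.

Lemma peak_shift (s t k l : int) a b x y : s ^+ 2 = 1 -> t ^+ 2 = 1 ->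
  peak 1 1 (s%:~R * a - k%:~R) (t%:~R * b - l%:~R) x y = peak s t a b x y :> R.
Proof.
have E (u j : int) (c z : R) : u ^+ 2 = 1 ->
    cos (2 * pi * (1%:~R * z - (u%:~R * c - j%:~R))) =
    cos (2 * pi * (u%:~R * z - c)).
  have -> : 1%:~R * z - (u%:~R * c - j%:~R) = z - u%:~R * c + j%:~R :> R.
    by ring.
  rewrite cos2piDint => /eqP; rewrite sqrf_eq1 => /orP[] /eqP ->.
    by rewrite !mul1r.
  by rewrite rmorphN /= -cosN; congr (cos _); ring.
by move=> s1 t1; rewrite !peakE !E.
Qed.

(** Otherwise a level c separates the two values, and by concentration the
    pairings of F - c with high powers of the peaks at v and at its reflection
    have opposite signs, while the symmetry of the moments makes them equal. *)
Lemma green_le (s t : int) v : s ^+ 2 = 1 -> t ^+ 2 = 1 -> to_torus v <> 0 ->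
  Fl v <= Fl (vec2 (s%:~R * v 0 0) (t%:~R * v 1 0)).
Proof.
move=> s1 t1 v0; set w := vec2 _ _; rewrite leNgt; apply/negP => lt_wv.
have sgn (u : int) : u ^+ 2 = 1 -> u = 1 \/ u = -1.
  by move=> /eqP; rewrite sqrf_eq1 => /orP[] /eqP; [left|right].
have w0 : to_torus w <> 0.
  move=> /to_torus_eq0/latticeP wZ; apply: v0; apply/to_torus_eq0/latticeP.
  have Z (u : int) (x : R) : u ^+ 2 = 1 ->
      u%:~R * x \is a Num.int -> x \is a Num.int.
    by move=> /sgn[] ->; rewrite ?mul1r // rmorphN mulN1r rpredN.
  apply: ord2P; [apply: (Z s) => //|apply: (Z t) => //].
    by have := wZ 0; rewrite vec2E0.
  by have := wZ 1; rewrite vec2E1.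
pose c := (Fl v + Fl w) / 2.
(* representatives of v and w in the unit square *)
have [k0 rk0] := unit_rep (v 0 0); have [k1 rk1] := unit_rep (v 1 0).
have [l0 rl0] := unit_rep (w 0 0); have [l1 rl1] := unit_rep (w 1 0).
pose f z := Fs z - c.
have shiftE (x u : R) (m k : int) :
    x - u - (m - k)%:~R = x - (u - k%:~R) - m%:~R by rewrite rmorphB /=; ring.
have fi : mu.-integrable US (EFin \o f) := integrable_centered c.
have [d [eps [d0 eps0 hd]]] :=
  @green_near v c false v0 ltac:(rewrite expr0 /c; lra).
have [d' [eps' [d'0 eps'0 hd']]] :=
  @green_near w c true w0 ltac:(rewrite expr1 /c; lra).
have [N0 hN0] : exists N0, forall N, (N0 <= N)%N -> 0 < pair_int f
    (fun z => peak 1 1 (v 0 0 - k0%:~R) (v 1 0 - k1%:~R) z.1 z.2 ^+ N).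
  apply: (peak_concentration fi rk0 rk1 d0 eps0) => m n x y hx hy.
  have := hd (m - k0) (n - k1) x y; rewrite expr0 mul1r; apply.
  - by rewrite shiftE.
  - by rewrite shiftE.
have fNi : mu.-integrable US (EFin \o (fun z => - f z)).
  have := @integrableN _ _ _ mu US _ fi.
  by congr (_.-integrable _ _).
have [N1 hN1] : exists N0, forall N, (N0 <= N)%N ->
    0 < pair_int (fun z => - f z)
    (fun z => peak 1 1 (w 0 0 - l0%:~R) (w 1 0 - l1%:~R) z.1 z.2 ^+ N).
  apply: (peak_concentration fNi rl0 rl1 d'0 eps'0) => m n x y hx hy.
  have := hd' (m - l0) (n - l1) x y; rewrite expr1 mulN1r; apply.
  - by rewrite shiftE.
  - by rewrite shiftE.
pose N := maxn N0 N1.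
have := hN0 N (leq_maxl _ _); have := hN1 N (leq_maxr _ _).
have mom m n p := @green_moments s t c m n p s1 t1.
have := pair_int_peakX fi (v 0 0) (v 1 0) mom N 0 0 0.
rewrite !mulr0.
have one z : wave 0 0 0 z.1 z.2 = 1 :> R.
  by rewrite /wave !mul0r !addr0 !mulr0 cos0.
have -> : pair_int f (fun z => peak 1 1 (v 0 0) (v 1 0) z.1 z.2 ^+ N
                             * wave 0 0 0 z.1 z.2) =
  pair_int f (fun z => peak 1 1 (v 0 0 - k0%:~R) (v 1 0 - k1%:~R) z.1 z.2 ^+ N).
  apply: eq_pair_int => z; rewrite one mulr1.
  have := @peak_shift 1 1 k0 k1 (v 0 0) (v 1 0) z.1 z.2; rewrite !mul1r.
  by move=> ->.
have -> : pair_int f (fun z => peak s t (v 0 0) (v 1 0) z.1 z.2 ^+ N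
                             * wave 0 0 0 z.1 z.2) =
  pair_int f (fun z => peak 1 1 (w 0 0 - l0%:~R) (w 1 0 - l1%:~R) z.1 z.2 ^+ N).
  apply: eq_pair_int => z; rewrite one mulr1.
  by rewrite /w vec2E0 vec2E1 peak_shift.
move=> -> hneg hpos.
have : pair_int (fun z => - f z)
    (fun z => peak 1 1 (w 0 0 - l0%:~R) (w 1 0 - l1%:~R) z.1 z.2 ^+ N) =
  - pair_int f
    (fun z => peak 1 1 (w 0 0 - l0%:~R) (w 1 0 - l1%:~R) z.1 z.2 ^+ N).
  have bp := bounded_meas_peakX 1 1 (w 0 0 - l0%:~R) (w 1 0 - l1%:~R) N.
  rewrite -[RHS]mulN1r -(pair_intZ fi _ bp).
  by apply: eq_Rintegral => z _; ring.
by move=> E; move: hpos; rewrite -oppr_lt0 -E ltNge (ltW hneg).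
Qed.

(** A reflection is an involution, so [green_le] applies in both directions. At
    the origin both sides are the value of F at 0. *)
Lemma green_sym (s t : int) x y : s ^+ 2 = 1 -> t ^+ 2 = 1 ->
  Fl (vec2 (s%:~R * x) (t%:~R * y)) = Fl (vec2 x y).
Proof.
move=> s1 t1.
have E (u : int) (z : R) : u ^+ 2 = 1 -> u%:~R * (u%:~R * z) = z.
  by move=> u1; rewrite mulrA -expr2 -rmorphXn u1 mul1r.
have [v0|v0] := pselect (to_torus (vec2 x y) = 0).
  rewrite /= v0; congr F; move: v0 => /to_torus_eq0/latticeP vZ.
  apply/to_torus_eq0/latticeP; apply: ord2P.
    by rewrite vec2E0 rpredM ?intr_int //; have := vZ 0; rewrite vec2E0.
  by rewrite vec2E1 rpredM ?intr_int //; have := vZ 1; rewrite vec2E1.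
have w0 : to_torus (vec2 (s%:~R * x) (t%:~R * y)) <> 0.
  move=> /to_torus_eq0/latticeP wZ; apply: v0; apply/to_torus_eq0/latticeP.
  apply: ord2P.
    rewrite vec2E0 -(E s x s1) rpredM ?intr_int //.
    by have := wZ 0; rewrite vec2E0.
  rewrite vec2E1 -(E t y t1) rpredM ?intr_int //.
  by have := wZ 1; rewrite vec2E1.
apply/eqP; rewrite eq_le; apply/andP; split.
  by have := green_le s1 t1 w0; rewrite vec2E0 vec2E1 !E.
by have := green_le s1 t1 v0; rewrite vec2E0 vec2E1.
Qed.

End Symmetry.

(** * Two facts on real differential inequalities *)

Section RealODE.
Variable R : realType.
Implicit Types (f Y : R -> R) (a b t s K : R).

(** Gronwall lemma: Y^2 exp (- 2 K t) is nonincreasing and starts at 0. *)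
Lemma gronwall0 Y K a b :
  {within `[a, b], continuous Y} -> Y a = 0 ->
  (forall t, a < t < b ->
     exists2 y', is_derive t 1 Y y' & `|y'| <= K * `|Y t|) ->
  forall t, a <= t <= b -> Y t = 0.
Proof.
move=> cY Ya dY t /andP[at_ tb].
pose h t := Y t ^+ 2 * expR (- (2 * K) * t).
have dE (s : R) : is_derive s 1 (fun t : R => expR (- (2 * K) * t))
    (expR (- (2 * K) * s) * (- (2 * K))).
  apply: (@is_derive1_comp _ expR ( *%R (- (2 * K)))).
  by apply: is_derive_eq; rewrite [_ *: 1]mulr1.
have dh s : a < s < b -> exists2 h', is_derive s 1 h h' & h' <= 0.
  move=> /dY[y' dy hy].
  exists (2 * (Y s * y' - K * Y s ^+ 2) * expR (- (2 * K) * s)).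
    have d2 := @is_deriveM _ _ Y Y s 1 _ _ dy dy.
    have d3 := @is_deriveM _ _ (Y * Y) _ s 1 _ _ d2 (dE s).
    apply: is_derive_eq d3 _.
    rewrite -![_ *: _]/(_ * _) /= mulrfctE; ring.
  rewrite mulrAC pmulr_rle0 ?mulr_gt0 ?expR_gt0 // subr_le0.
  apply: le_trans (ler_norm _) _.
  rewrite normrM -[Y s ^+ 2]ger0_norm ?sqr_ge0 //.
  by rewrite normrX expr2; have := normr_ge0 (Y s); nra.
have ch : {within `[a, b], continuous h}.
  have cE : {within `[a, b], continuous (fun t : R => expR (- (2 * K) * t))}.
    apply: continuous_subspaceT => s; apply: differentiable_continuous.
    by apply/derivable1_diffP; exact: ex_derive.
  by move=> x; exact: (continuousM (continuousM (cY x) (cY x)) (cE x)).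
have dh1 s : s \in `]a, b[%R -> derivable h s 1.
  by rewrite in_itv /= => /dh[h' dh' _]; exact: ex_derive.
have dh2 s : s \in `]a, b[%R -> derive1 h s <= 0.
  by rewrite in_itv /= => /dh[h' dh' ?]; rewrite derive1E derive_val.
have H : h t <= 0.
  have -> : 0 = h a by rewrite /h Ya expr0n mul0r.
  apply: (ler0_derive1_le_cc dh1 dh2 ch) => //; rewrite in_itv /= ?lexx ?at_ //.
  exact: le_trans tb.
move: H; rewrite /h pmulr_lle0 ?expR_gt0 // => H.
by apply/eqP; rewrite -sqrf_eq0 eq_le H sqr_ge0.
Qed.

(** The bound |Y'| <= K |Y| is only required near the zeros of Y, with K
    depending on the zero. The supremum s of the times up to which Y vanishes is
    a zero of Y, and [gronwall0] at s pushes the vanishing beyond s if s < b. *)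
Lemma vanish_of_local_gronwall Y b : 0 <= b ->
  {within `[0, b], continuous Y} -> Y 0 = 0 ->
  (forall s, 0 <= s <= b -> Y s = 0 -> exists2 e, 0 < e &
     exists K, forall t, 0 < t < b -> `|t - s| < e ->
       exists2 y', is_derive t 1 Y y' & `|y'| <= K * `|Y t|) ->
  forall t, 0 <= t <= b -> Y t = 0.
Proof.
move=> b0 cY Y0 loc.
pose S := [set s | 0 <= s <= b /\ forall u, 0 <= u <= s -> Y u = 0].
have S0 : S 0.
  split=> [|u u0]; first by rewrite lexx.
  by have -> : u = 0 by apply/le_anti; rewrite andbC.
have supS : has_sup S by split; [exists 0|exists b => s [/andP[]]].
pose s := sup S.
have s0 : 0 <= s by apply: sup_upper_bound.
have sb : s <= b by apply: ge_sup; [exists 0|move=> u [/andP[]]].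
have below u : 0 <= u < s -> Y u = 0.
  move=> /andP[u0 us]; have [v [vb vS] uv] := sup_gt supS.1 us.
  by apply: vS; rewrite u0 ltW.
have within0 c d : 0 <= c -> d <= b -> {within `[c, d], continuous Y}.
  move=> c0 db; apply: continuous_subspaceW cY => u /=; rewrite !in_itv /=.
  by move=> /andP[? ?]; apply/andP; split; lra.
(* on ]0, s[ both Y and the bound on its derivative vanish, so K = 0 is
   allowed there; this gives Y s = 0 with only continuity at s *)
have Ys : Y s = 0.
  apply: (@gronwall0 Y 0 0 s); rewrite ?lexx ?s0 //; first exact: within0.
  move=> t /andP[t0 ts].
  have Yt : Y t = 0 by apply: below; rewrite ltW.
  have [|e e0 [K h]] := loc t _ Yt; first by apply/andP; split; lra.
  have [| |y' d hy] := h t; first by apply/andP; split; lra.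
    by rewrite subrr normr0.
  by exists y' => //; rewrite mul0r; move: hy; rewrite Yt normr0 mulr0.
have upto u : 0 <= u <= s -> Y u = 0.
  move=> /andP[u0]; rewrite le_eqVlt => /predU1P[->//|us].
  by apply: below; rewrite u0.
have [sE|sne] := eqVneq s b; first by move=> t; rewrite -sE; exact: upto.
have ltsb : s < b by rewrite lt_neqAle sne.
have [|e e0 [K h]] := loc s _ Ys; first by rewrite s0.
pose r := Num.min b (s + e / 2).
have sr : s < r by rewrite lt_min ltsb ltrDl divr_gt0.
have rb : r <= b by rewrite ge_min lexx.
have re : r <= s + e / 2 by rewrite ge_min lexx orbT.
suff : r <= s by move=> rs; exfalso; lra.
apply: sup_upper_bound => //; split; first by rewrite rb andbT; lra.
move=> u /andP[u0 ur].
have [us|su] := leP u s; first by apply: upto; rewrite u0.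
apply: (@gronwall0 Y K s r) => //; first exact: within0.
  move=> t /andP[st tr]; apply: h; first by apply/andP; split; lra.
  by rewrite ger0_norm; lra.
by rewrite ltW.
Qed.

Lemma constant_within f b : 0 <= b ->
  {within `[0, b], continuous f} ->
  (forall t, 0 < t < b -> is_derive t 1 f 0) -> f b = f 0.
Proof.
move=> b0 cf df.
have df' (t : R) : t \in `]0, b[%R -> is_derive t 1 f 0.
  by rewrite in_itv /= => /df.
have [c _] := MVT_segment b0 df' cf.
by rewrite mul0r => /eqP; rewrite subr_eq0 => /eqP.
Qed.

End RealODE.

Section Lifespan.
Variables (R : realType) (T : \bar R).
Implicit Types t : R.

Lemma lifespan0 : (0 < T)%E -> lifespan T 0.
Proof. by []. Qed.

Lemma lifespan_sub t : lifespan T t -> `[0, t]%classic `<=` lifespan T.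
Proof.
move=> [t0 tT] s /=; rewrite in_itv /= => /andP[s0 st]; split=> //.
by apply: le_lt_trans tT; rewrite lee_fin.
Qed.

Lemma lifespan_interval : is_interval (lifespan T).
Proof.
move=> x y [x0 _] Ty z /andP[xz zy].
apply: (lifespan_sub Ty); rewrite /= in_itv /= zy andbT; exact: le_trans xz.
Qed.

(** The times at which the differential equation is imposed. *)
Definition interior_time := [set t | 0 < t /\ (t%:E < T)%E].

Lemma interior_lifespan t : interior_time t -> lifespan T t.
Proof. by move=> [t0 tT]; split=> //; exact: ltW. Qed.

Lemma open_interior_time : open interior_time.
Proof.
have -> : interior_time = `]0, +oo[%classic `&` [set t : R | (t%:E < T)%E].
  by apply/seteqP; split=> t /=; rewrite in_itv /= andbT.
apply: openI; first exact: interval_open.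
case: T => [r| |].
- have -> : [set t : R | (t%:E < r%:E)%E] = `]-oo, r[%classic.
    by apply/seteqP; split=> t /=; rewrite in_itv /= lte_fin.
  exact: interval_open.
- have -> : [set t : R | (t%:E < +oo)%E] = setT.
    by apply/seteqP; split=> t //= _; rewrite ltry.
  exact: openT.
- have -> : [set t : R | (t%:E < -oo)%E] = set0.
    by apply/seteqP; split=> t //=.
  exact: open0.
Qed.

Lemma near_lifespan t : interior_time t -> \forall s \near t, lifespan T s.
Proof.
move=> it; have := open_nbhs_nbhs (conj open_interior_time it).
by apply: filterS => s; exact: interior_lifespan.
Qed.

Lemma continuous_at_interior (U : topologicalType) (f : R -> U) t :
  {within lifespan T, continuous f} -> interior_time t ->
  {for t, continuous f}.
Proof.
move=> cf it.
have : {within interior_time, continuous f}.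
  by apply: continuous_subspaceW cf => s; exact: interior_lifespan.
rewrite continuous_open_subspace; last exact: open_interior_time.
by apply; rewrite inE.
Qed.

Lemma within_comp (U V : topologicalType) (f : R -> U) (g : U -> V) :
  {within lifespan T, continuous f} -> continuous g ->
  {within lifespan T, continuous (fun t => g (f t))}.
Proof.
move=> cf cg x.
by apply: (@continuous_comp (subspace _) _ _ f g); [exact: cf|exact: cg].
Qed.

Lemma within_sub (U : topologicalType) (f : R -> U) t :
  {within lifespan T, continuous f} -> lifespan T t ->
  {within `[0, t], continuous f}.
Proof.
by move=> cf Tt; apply: continuous_subspaceW cf; exact: lifespan_sub.
Qed.

End Lifespan.

(** * The gradient of the energy *)

Section Gradient.
Variable R : realType.
Variable F : torus R -> R.
Hypothesis gF : is_green F.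
Local Notation Fl := (F \o @to_torus R).

Lemma green_even x : F (- x) = F x.
Proof.
have [v <-] := to_torus_surj x.
have := @green_sym _ _ gF (-1) (-1) (v 0 0) (v 1 0); rewrite sqrrN expr1n.
move=> /(_ erefl erefl) /=; rewrite vec2_eta => <-; rewrite -to_torusN.
by congr (F (to_torus _)); apply: cV2P; rewrite !mxE /= rmorphN /= mulN1r.
Qed.

Lemma green_reflect x y : Fl (vec2 x (- y)) = Fl (vec2 x y).
Proof.
have := @green_sym _ _ gF 1 (-1) x y; rewrite sqrrN expr1n.
by move=> /(_ erefl erefl); rewrite mul1r rmorphN /= mulN1r.
Qed.

Lemma green_derive (s : seq 'I_2) (i : 'I_2) v : to_torus v <> 0 ->
  is_derive (0 : R) 1
    (fun t : R => foldr (@partial R) Fl s (t *: delta_mx i 0 + v))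
    (foldr (@partial R) Fl (i :: s) v).
Proof.
move=> v0; apply: (is_derive_line (foldr (@partial R) Fl s) v _ _).1.
by have /derivableP :=
  @diff_derivable _ _ _ _ _ (delta_mx i 0) (green_smooth gF s v0).
Qed.

(** In the vertical variable F is even around the axis, and the derivative of an
    even function vanishes at 0. *)
Lemma partial1_axis x : to_torus (vec2 x 0) <> 0 -> partial 1 Fl (vec2 x 0) = 0.
Proof.
move=> v0; have := green_derive [::] 1 v0; rewrite /=.
set d := partial 1 Fl _; set f := (X in is_derive _ _ X) => df.
have fN t : f (- t) = f t.
  have E u : u *: delta_mx 1 0 + vec2 x 0 = vec2 x u.
    by apply: cV2P; rewrite !mxE /= ?mulr0 ?mulr1 ?add0r ?addr0.
  by rewrite /f !E; exact: green_reflect.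
have dN : is_derive (0 : R) 1 (fun t => f (- t)) (d * -1).
  apply: (@is_derive1_comp _ f -%R); by rewrite oppr0.
have E : (fun t => f (- t)) = f by apply/funext => t; exact: fN.
rewrite E in dN; case: df => _ df; case: dN => _ dN.
by move: dN; rewrite df; lra.
Qed.

(** Moving a_j by h moves the lift r of a_1 - a_2 by d_j h and q by
    2 pi d_j h; as F is even, the energy is 2 pi F (r) + |q|^2 / 2. *)
Lemma grad_energyE (j : 'I_2) (a : 'I_2 -> torus R) (q r : 'cV[R]_2) :
  to_torus r = a 0 - a 1 -> a 0 <> a 1 ->
  grad_energy F j a q = (2 * pi * deg R j) *: (grad Fl r + q).
Proof.
move=> ra a01; have r0 : to_torus r <> 0.
  by rewrite ra => /eqP; rewrite subr_eq0 => /eqP.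
apply/colP => i; rewrite !mxE.
set E := (fun h : 'cV[R]_2 => energy _ _ _).
have EE h : E h = 2 * pi * Fl (r + deg R j *: h)
     + 2^-1 * \sum_k (q k 0 + 2 * pi * deg R j * h k 0) ^+ 2.
  rewrite /E /energy; congr (_ + _ * _); last first.
    by apply: eq_bigr => k _; rewrite !mxE.
  pose b k := if k == j then a k + to_torus h else a k.
  have pairs : \sum_(l : 'I_2) \sum_(k | k != l)
      deg R l * deg R k * F (b l - b k)
     = - F (b 0 - b 1) - F (b 1 - b 0).
    have -> : 1 = lift 0 0 :> 'I_2 by exact/val_inj.
    rewrite !big_ord_recl !big_ord0 /= !(big_mkcond (fun k => k != _)) /=.
    by rewrite !big_ord_recl !big_ord0 /= /deg /=; ring.
  rewrite -/b pairs {pairs}.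
  have -> : b 1 - b 0 = - (b 0 - b 1) by rewrite opprB.
  rewrite green_even.
  have -> : b 0 - b 1 = to_torus (r + deg R j *: h).
    rewrite to_torusD ra /b /deg; move: j {E b}; apply: ord2P => /=.
      by rewrite scale1r addrAC.
    by rewrite scaleN1r to_torusN opprD addrA.
  by rewrite /=; ring.
rewrite /partial derive_line.
have -> : (fun t : R => E (t *: delta_mx i 0 + 0)) = (fun t : R =>
     2 * pi * Fl ((deg R j * t) *: delta_mx i 0 + r)
     + 2^-1 * \sum_k (q k 0 + 2 * pi * deg R j * (k == i)%:R * t) ^+ 2).
  apply/funext => t; rewrite EE addr0 scalerA addrC [_ + r]addrC addrC.
  congr (_ + _ * _); apply: eq_bigr => k _; rewrite !mxE eqxx andbT.
  by congr (_ ^+ 2); ring.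
have dF := green_derive [::] i r0; rewrite /= in dF.
have dl : is_derive (0 : R) 1 ( *%R (deg R j)) (deg R j).
  by apply: is_derive_eq; rewrite [_ *: 1]mulr1.
have dFl : is_derive (0 : R) 1
    (fun t : R => Fl ((deg R j * t) *: delta_mx i 0 + r))
    (partial i Fl r * deg R j).
  apply: (@is_derive1_comp _ (fun t : R => Fl (t *: delta_mx i 0 + r))
    ( *%R (deg R j))).
  by rewrite mulr0.
have dk (k : 'I_2) : is_derive (0 : R) 1
    (fun t : R => (q k 0 + 2 * pi * deg R j * (k == i)%:R * t) ^+ 2)
    (2 * q k 0 * (2 * pi * deg R j * (k == i)%:R)).
  set c := _ * (k == i)%:R.
  have dc : is_derive (0 : R) 1 (fun t : R => q k 0 + c * t) c.
    by apply: is_derive_eq; rewrite -![_ *: _]/(_ * _); ring.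
  have := @is_deriveM _ _ (fun t : R => q k 0 + c * t) _ 0 1 _ _ dc dc.
  rewrite mulr0 addr0 => H; apply: is_derive_eq H _.
  by rewrite -![_ *: _]/(_ * _); ring.
have dS : is_derive (0 : R) 1
    (fun t : R => \sum_k (q k 0 + 2 * pi * deg R j * (k == i)%:R * t) ^+ 2)
    (2 * q i 0 * (2 * pi * deg R j)).
  have := is_deriveD (dk 0) (dk (lift 0 0)).
  have -> : (fun t : R => (q 0 0 + 2 * pi * deg R j * (0 == i)%:R * t) ^+ 2)
    + (fun t : R => (q (lift 0 0) 0
                     + 2 * pi * deg R j * (lift 0 0 == i)%:R * t) ^+ 2) =
    (fun t : R => \sum_k (q k 0 + 2 * pi * deg R j * (k == i)%:R * t) ^+ 2).
    by apply/funext => t; rewrite !big_ord_recl big_ord0 addr0.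
  move=> H; apply: is_derive_eq H _.
  have -> : lift 0 0 = 1 :> 'I_2 by exact/val_inj.
  by move: i {dk dFl dF}; apply: ord2P => /=; ring.
have := is_deriveD (is_deriveZ (2 * pi) dFl) (is_deriveZ 2^-1 dS).
case=> _; rewrite -![_ *: (_ : R)]/(_ * _) => H.
apply: etrans H _; rewrite -/(partial i Fl r).
by move: (partial _ _ _) (deg R j) (q i 0) (pi : R) => *; field.
Qed.

(** The partial derivative in y vanishes on the axis, and its own derivative in
    y is bounded near the point: mean value theorem. *)
Lemma partial1_lipschitz x0 : to_torus (vec2 x0 0) <> 0 ->
  exists2 d, 0 < d & exists L, forall x y, `|x - x0| < d -> `|y| < d ->
    `|partial 1 Fl (vec2 x y)| <= L * `|y|.
Proof.
move=> v0; set h := partial 1 Fl; set h2 := partial 1 h.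
have c2 : {for vec2 x0 0, continuous h2}.
  exact: differentiable_continuous (green_smooth gF [:: 1; 1] v0).
pose L : R := `|h2 (vec2 x0 0)| + 1.
have nL : \forall v \near vec2 x0 0, `|h2 v| < L.
  have C : (fun v => `|h2 v|) @ vec2 x0 0 --> `|h2 (vec2 x0 0)|.
    exact: (@continuous_comp _ _ _ h2 (fun x : R => `|x|) _ c2
      (@norm_continuous _ R _)).
  by apply: (cvgr_lt _ C); rewrite ltrDl.
have nz : \forall v \near vec2 x0 0, to_torus v <> 0.
  exact: open_nbhs_nbhs (conj (@open_nonlattice R) v0).
have /nbhs_ballP[d /= d0 hd] :
    \forall v \near vec2 x0 0, `|h2 v| < L /\ to_torus v <> 0.
  exact: filterI nL nz.
have inb x y : `|x - x0| < d -> `|y| < d ->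
    `|h2 (vec2 x y)| < L /\ to_torus (vec2 x y) <> 0.
  move=> hx hy; apply: hd; split=> // i j; rewrite (ord1 j).
  move: i; apply: ord2P; rewrite /ball /= !mxE /=; first by rewrite distrC.
  by rewrite sub0r normrN.
exists d => //; exists L => x y hx hy.
have dh (u : R) : `|u| < d ->
    is_derive u 1 (fun s : R => h (vec2 x s)) (h2 (vec2 x u)).
  move=> hu; have := green_derive [:: 1] 1 (inb _ _ hx hu).2.
  rewrite /= -/h -/h2 => D.
  have ds : is_derive u 1 (fun s : R => s - u) 1.
    by apply: is_derive_eq; rewrite subr0.
  rewrite -(subrr u) in D.
  have := @is_derive1_comp _ _ (fun s : R => s - u) u _ _ D ds; rewrite mulr1.
  congr (is_derive _ _ _ _); apply/funext => s /=; congr (h _).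
  by apply: cV2P; rewrite !mxE /= ?mulr0 ?mulr1 ?add0r ?subrK.
have h0 : h (vec2 x 0) = 0.
  by apply: partial1_axis; apply: (inb x 0 hx _).2; rewrite normr0.
have cont (u v : R) : (forall s, u <= s <= v -> `|s| < d) ->
    {within `[u, v], continuous (fun s : R => h (vec2 x s))}.
  move=> us; apply: derivable_within_continuous => s.
  rewrite in_itv /= => /us /dh ?.
  exact: ex_derive.
have main (u v : R) : u <= v -> (forall s, u <= s <= v -> `|s| < d) ->
    `|h (vec2 x v) - h (vec2 x u)| <= L * `|v - u|.
  move=> uv us; have df (s : R) : s \in `]u, v[%R ->
      is_derive s 1 (fun s : R => h (vec2 x s)) (h2 (vec2 x s)).
    by rewrite in_itv /= => /andP[? ?]; apply: dh; apply: us; rewrite !ltW.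
  have [c] := MVT_segment uv df (cont _ _ us).
  rewrite in_itv /= => /us hc ->; rewrite normrM ler_wpM2r //.
  exact: ltW (inb x c hx hc).1.
have [y0|y0] := leP 0 y.
  have := main 0 y y0; rewrite h0 !subr0; apply=> s /andP[s0 sy].
  by rewrite ger0_norm // (le_lt_trans sy) // (le_lt_trans (ler_norm y)).
have := main y 0 (ltW y0); rewrite h0 !sub0r !normrN; apply=> s /andP[ys s0].
by rewrite ler0_norm //; move: hy; rewrite ltr0_norm //; lra.
Unshelve. all: by end_near. Qed.

End Gradient.

Section TorusCurves.
Variable R : realType.

Lemma is_derive_coord (A : R -> 'cV[R]_2) (t : R) (v : 'cV[R]_2) (i : 'I_2) :
  is_derive t 1 A v -> is_derive t 1 (fun s => A s i 0) (v i 0).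
Proof.
case=> dA <-; split; first exact: (derivable_mxP _ _ _).1 dA i 0.
by rewrite derive_mx // mxE.
Qed.

Lemma torus_fun_continuous (g : torus R -> R) :
  continuous (g \o @to_torus R) -> continuous g.
Proof.
by move=> /continuousP cg; apply/continuousP => U /cg.
Qed.

(** Distinct lattice points differ by at least 1 in some coordinate. *)
Lemma locally_constant_lattice (D : R -> 'cV[R]_2) t :
  {for t, continuous D} -> (\forall s \near t, D s \in lattice R) ->
  \forall s \near t, D s = D t.
Proof.
move=> cD nD; have Dt : D t \in lattice R by exact: nbhs_singleton nD.
have nb : \forall s \near t, ball (D t) 1 (D s).
  exact: cD _ (nbhsx_ballx _ _ ltr01).
near=> s; have Ds : D s \in lattice R by near: s.
have : ball (D t) 1 (D s) by near: s.
move=> [_ bD]; apply/colP => i.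
have := bD i 0; rewrite /ball /= => lt1.
have /intrP[k hk] : D t i 0 - D s i 0 \is a Num.int.
  by rewrite rpredB //; [move/latticeP: Dt|move/latticeP: Ds]; apply.
move: lt1; rewrite hk -intr_norm -[1]/(1%:~R) ltr_int => k1.
have k0 : k = 0 by lia.
by apply/esym/eqP; rewrite -subr_eq0 hk k0.
Unshelve. all: by end_near. Qed.

(** The cosine (p = 0) and the sine (p = - pi / 2) of 2 pi times a coordinate
    are well defined and continuous on the torus. *)
Lemma torus_trig (i : 'I_2) (p : R) : exists2 g : torus R -> R,
  forall v, g (to_torus v) = cos (2 * pi * v i 0 + p) & continuous g.
Proof.
pose m : int := if i == 0 then 1 else 0.
pose n : int := if i == 0 then 0 else 1.
have [g gE] := torus_factor (@wavev_periodic R m n p).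
exists g => [v|].
  have := congr1 (fun f => f v) gE => /= ->; rewrite /wavev /wave.
  congr (cos (_ * _ + _)); rewrite /m /n.
  by move: i {m n gE}; apply: ord2P => /=; ring.
apply: torus_fun_continuous; rewrite gE => v.
apply: differentiable_continuous; rewrite [X in differentiable X _](_ : _ =
  fun u => 1 * wavev m n p u); first exact: differentiable_wavev.
by apply/funext => u; rewrite mul1r.
Qed.

(** The function cos (2 pi (c_i - X)), well defined although c_i is only defined
    modulo 1, starts at 1 and has zero derivative, whatever local lift of c is
    used to differentiate it. So it is constant and c_i - X is an integer. *)
Lemma torus_curve_coord (T : \bar R) (c : R -> torus R) (X : R -> R)
    (i : 'I_2) :
  {within lifespan T, continuous c} -> {within lifespan T, continuous X} ->
  (exists2 v, c 0 = to_torus v & X 0 = v i 0) ->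
  (forall t, interior_time T t ->
     exists2 v, has_velocity c t v & is_derive t 1 X (v i 0)) ->
  forall t z, lifespan T t -> c t = to_torus z -> z i 0 - X t \is a Num.int.
Proof.
move=> cc cX [v0 c0 X0] vel t z Tt ctz.
have [gc gcE cgc] := torus_trig i 0.
have [gs gsE cgs] := torus_trig i (- (pi / 2)).
pose f s := gc (c s) * cos (2 * pi * X s) + gs (c s) * sin (2 * pi * X s).
have fE s w : c s = to_torus w -> f s = cos (2 * pi * (w i 0 - X s)).
  by move=> cw; rewrite /f cw gcE gsE addr0 cosBpihalf mulrBr cosB.
have t0 : 0 <= t by case: Tt.
have c2 : continuous ( *%R (2 * pi) : R -> R) by exact: mulrl_continuous.
have cf : {within lifespan T, continuous f}.
  have cosX := within_comp (within_comp cX c2) (@continuous_cos R).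
  have sinX := within_comp (within_comp cX c2) (@continuous_sin R).
  have gcc := within_comp cc cgc; have gsc := within_comp cc cgs.
  move=> x; exact: (continuousD (continuousM (gcc x) (cosX x))
                                (continuousM (gsc x) (sinX x))).
have df s : 0 < s < t -> is_derive s 1 f 0.
  move=> /andP[s0 st].
  have Is : interior_time T s.
    by split=> //; case: Tt => _; apply: lt_trans; rewrite lte_fin.
  have [v [A [nA dA]] dX] := vel s Is.
  pose w u := A u i 0 - X u.
  have dw : is_derive s 1 w 0.
    by have := is_deriveB (is_derive_coord i dA) dX; rewrite subrr.
  have dw2 : is_derive s 1 (fun u => 2 * pi * w u) 0.
    by have := is_deriveZ (2 * pi) dw; rewrite scaler0.
  have := @is_derive1_comp _ cos (fun u => 2 * pi * w u) s _ _
    (is_derive_cos _) dw2.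
  rewrite mulr0; apply: near_eq_is_derive.
  by apply: filterS nA => u Au; rewrite (fE u (A u)).
have := constant_within t0 (within_sub cf Tt) df.
rewrite (fE t z ctz) (fE 0 v0 c0) X0 subrr mulr0 cos0.
exact: cos2pi_eq1.
Qed.

Lemma torus_curve_eq (T : \bar R) (c : R -> torus R) (x y : R -> R) :
  {within lifespan T, continuous c} ->
  {within lifespan T, continuous x} -> {within lifespan T, continuous y} ->
  c 0 = to_torus (vec2 (x 0) (y 0)) ->
  (forall t, interior_time T t -> exists v, [/\ has_velocity c t v,
     is_derive t 1 x (v 0 0) & is_derive t 1 y (v 1 0)]) ->
  forall t, lifespan T t -> c t = to_torus (vec2 (x t) (y t)).
Proof.
move=> cc cx cy c0 vel t Tt.
have [z zE] := to_torus_surj (c t).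
rewrite -zE; apply/to_torus_eq/latticeP; apply: ord2P; rewrite !mxE /=.
- apply: (torus_curve_coord cc cx _ _ Tt (esym zE)).
    by exists (vec2 (x 0) (y 0)); rewrite ?vec2E0.
  by move=> s /vel[v [? ? ?]]; exists v.
- apply: (torus_curve_coord cc cy _ _ Tt (esym zE)).
    by exists (vec2 (x 0) (y 0)); rewrite ?vec2E1.
  by move=> s /vel[v [? ? ?]]; exists v.
Qed.

End TorusCurves.

(** * The relative position of the two vortices *)

Section Solution.
Variables (R : realType) (lam : R) (F : torus R -> R).
Variables (a0 : 'I_2 -> torus R) (q0 : 'cV[R]_2) (T : \bar R).
Variables (a : R -> 'I_2 -> torus R) (q : R -> 'cV[R]_2).
Hypothesis gF : is_green F.
Hypothesis sol : is_solution lam F a0 q0 T a q.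
Local Notation Fl := (F \o @to_torus R).

(** The lift of a_1 - a_2 to the plane selected by the flux branch. *)
Definition sep t : 'cV[R]_2 := (2 * pi)^-1 *: q t.

Let pi2_neq0 : 2 * pi != 0 :> R.
Proof. by rewrite mulf_neq0 // gt_eqF ?pi_gt0. Qed.

Let lam_gt0 : 0 < 1 + lam ^+ 2.
Proof. by rewrite ltr_wpDr ?sqr_ge0. Qed.

Lemma sepE t : q t = (2 * pi) *: sep t.
Proof. by rewrite scalerA divff // scale1r. Qed.

Lemma sep_torus t : lifespan T t -> to_torus (sep t) = a t 0 - a t 1.
Proof.
move=> /(flux_branch sol)[x [k [xa kZ qE]]].
have -> : sep t = (x 0 - x 1) + k.
  rewrite /sep qE -scalerDr scalerA mulVf // scale1r; congr (_ + _).
  have e1 : lift 0 0 = 1 :> 'I_2 by exact/val_inj.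
  by rewrite !big_ord_recl big_ord0 addr0 e1 /deg /= scale1r scaleN1r.
by rewrite to_torusD to_torusB !xa (to_torus_eq0 k).2 ?addr0.
Qed.

Lemma sep_neq0 t : lifespan T t -> to_torus (sep t) <> 0.
Proof.
move=> Tt; rewrite sep_torus // => /eqP; rewrite subr_eq0 => /eqP.
exact: sol_distinct sol _ Tt.
Qed.

(** The vector grad F (r) + q; both vortices move under this vector, up to sign
    and rotation. *)
Definition force t (i : 'I_2) : R :=
  partial i Fl (sep t) + 2 * pi * sep t i 0.

(** Inversion of I - lam d J, whose inverse is (I + lam d J) / (1 + lam^2) when
    d is 1 or -1. *)
Lemma mobility_solve (d f0 f1 : R) (v : 'cV[R]_2) : d ^+ 2 = 1 ->
  v - (lam * d) *: (JJ R *m v) = vec2 (- 2 * d * f0) (- 2 * d * f1) ->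
  v 0 0 = - 2 * (d * f0 + lam * f1) / (1 + lam ^+ 2) /\
  v 1 0 = - 2 * (d * f1 - lam * f0) / (1 + lam ^+ 2).
Proof.
move=> d1 E.
have := congr1 (fun M : 'cV[R]_2 => M 0 0) E.
have := congr1 (fun M : 'cV[R]_2 => M 1 0) E.
have e1 : lift 0 0 = 1 :> 'I_2 by exact/val_inj.
rewrite !mxE !big_ord_recl !big_ord0 !mxE e1 /=.
rewrite !mul0r !add0r !addr0 mul1r mulN1r => E1 E0.
have ln : 1 + lam ^+ 2 != 0 by rewrite gt_eqF.
split; apply: (canRL (mulfK ln)).
  have -> : v 0 0 * (1 + lam ^+ 2) =
    (v 0 0 - lam * d * v 1 0) + lam * d * (v 1 0 - lam * d * - v 0 0)
    + v 0 0 * lam ^+ 2 * (1 - d ^+ 2) by ring.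
  by rewrite E0 E1 d1; ring: d1.
have -> : v 1 0 * (1 + lam ^+ 2) =
    (v 1 0 - lam * d * - v 0 0) - lam * d * (v 0 0 - lam * d * v 1 0)
    + v 1 0 * lam ^+ 2 * (1 - d ^+ 2) by ring.
by rewrite E0 E1 d1; ring: d1.
Qed.

Lemma velocity (j : 'I_2) t : interior_time T t ->
  exists v, [/\ has_velocity (fun s => a s j) t v,
   v 0 0 = - 2 * (deg R j * force t 0 + lam * force t 1) / (1 + lam ^+ 2) &
   v 1 0 = - 2 * (deg R j * force t 1 - lam * force t 0) / (1 + lam ^+ 2)].
Proof.
move=> it; have Tt := interior_lifespan it.
have [v [vel E]] := sol_ode sol it.1 it.2 j.
exists v.
have [|//|-> ->] := @mobility_solve (deg R j) (force t 0) (force t 1) v;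
  last by [].
  by rewrite /deg; case: ifP; rewrite ?sqrrN expr1n.
rewrite E (grad_energyE gF _ _ (sep_torus Tt));
  last exact: sol_distinct sol _ Tt.
rewrite scalerA sepE.
have -> : - pi^-1 * (2 * pi * deg R j) = - 2 * deg R j.
  have := pi_gt0 R; move: (pi : R) (deg R j) => P d P0.
  by field; rewrite gt_eqF.
by apply: cV2P; rewrite /force mxE [RHS]mxE /=; congr (_ * _); rewrite !mxE /=.
Qed.

Lemma sep_continuous (i : 'I_2) :
  {within lifespan T, continuous (fun t => sep t i 0)}.
Proof.
have E : (fun t => sep t i 0) = (fun t => (2 * pi)^-1 * q t i 0).
  by apply/funext => t; rewrite mxE.
rewrite E.
apply: (within_comp (within_comp (flux_continuous sol) (@coord_cvg R i))).
exact: mulrl_continuous.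
Qed.

(** A difference of local lifts of a_1 and a_2 is differentiable at t, and [sep]
    differs from it by a locally constant lattice point. *)
Lemma sep_derive (i : 'I_2) t : interior_time T t ->
  is_derive t 1 (fun s => sep s i 0) (- 4 * force t i / (1 + lam ^+ 2)).
Proof.
move=> it; have [v [[A [nA dA]] v0 v1]] := velocity 0 it.
have [w [[B [nB dB]] w0 w1]] := velocity 1 it.
pose D s := sep s - (A s - B s).
have cD : {for t, continuous D}.
  have cA : {for t, continuous A}.
    by apply: differentiable_continuous; apply/derivable1_diffP; case: dA.
  have cB : {for t, continuous B}.
    by apply: differentiable_continuous; apply/derivable1_diffP; case: dB.
  have cq : {for t, continuous sep}.
    apply: (@continuous_comp _ _ _ q ( *:%R (2 * pi)^-1)).
      exact: continuous_at_interior (flux_continuous sol) it.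
    exact: scaler_continuous.
  exact: continuousB cq (continuousB cA cB).
have nD : \forall s \near t, D s \in lattice R.
  near=> s; apply/to_torus_eq.
  rewrite sep_torus; last by near: s; exact: near_lifespan.
  by rewrite to_torusB; congr (_ - _); apply/esym; near: s.
have := locally_constant_lattice cD nD => nDt.
have dAB := is_deriveB (is_derive_coord i dA) (is_derive_coord i dB).
have := is_deriveD dAB (is_derive_cst (D t i 0) t 1); rewrite addr0.
have -> : v i 0 - w i 0 = - 4 * force t i / (1 + lam ^+ 2).
  move: i {dAB}; apply: ord2P; rewrite ?v0 ?v1 ?w0 ?w1 /deg /=;
    by field; rewrite gt_eqF.
apply: near_eq_is_derive; apply: filterS nDt => s Ds.
have -> : sep s i 0 = (A s i 0 - B s i 0) + D s i 0.
  rewrite [D s i 0]mxE [(- _ : 'cV_2) i 0]mxE [(A s - B s) i 0]mxE.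
  by rewrite [(- B s) i 0]mxE; ring.
by rewrite Ds.
Unshelve. all: by end_near. Qed.

Lemma within_near (f : R -> R) b s (e : R) : {within `[0, b], continuous f} ->
  0 <= s <= b -> 0 < e ->
  exists2 d, 0 < d & forall t, 0 <= t <= b -> `|t - s| < d -> `|f t - f s| < e.
Proof.
move=> /subspace_continuousP cf sb e0.
have /cf C : `[0, b]%classic s by rewrite /= in_itv.
have /cvgr_dist_lt /(_ e e0) :
  f x @[x --> within `[0, b]%classic (nbhs s)] --> f s by [].
rewrite near_withinE => /nbhs_ballP[d /= d0 hd]; exists d => // t tb ts.
rewrite distrC; apply: hd; first by rewrite /ball /= distrC.
by rewrite in_itv.
Qed.

(** The horizontal axis is invariant: near a point of it the vertical force is
    at most a multiple of the vertical coordinate ([partial1_lipschitz]). *)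
Lemma sep1_eq0 : sep 0 1 0 = 0 -> forall t, lifespan T t -> sep t 1 0 = 0.
Proof.
move=> Y0 b Tb; have b0 : 0 <= b by case: Tb.
have cX := within_sub (@sep_continuous 0) Tb.
have cY := within_sub (@sep_continuous 1) Tb.
apply: (vanish_of_local_gronwall b0 cY Y0); last by rewrite b0 lexx.
move=> s sb Ys.
have Ts : lifespan T s by apply: (lifespan_sub Tb); rewrite /= in_itv.
have sE : vec2 (sep s 0 0) 0 = sep s by rewrite -[RHS]vec2_eta Ys.
have := sep_neq0 Ts; rewrite -sE => /(partial1_lipschitz gF)[d d0 [L lip]].
have [e1 e10 h1] := within_near cX sb d0.
have [e2 e20 h2] := within_near cY sb d0.
exists (Num.min e1 e2); first by rewrite lt_min e10.
exists (4 / (1 + lam ^+ 2) * (L + 2 * pi)) => t /andP[t0 tb].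
rewrite lt_min => /andP[te1 te2].
have it : interior_time T t.
  by split=> //; case: Tb => _; apply: lt_trans; rewrite lte_fin.
exists (- 4 * force t 1 / (1 + lam ^+ 2)); first exact: sep_derive.
have tI : 0 <= t <= b by rewrite !ltW.
have := lip (sep t 0 0) (sep t 1 0) (h1 _ tI te1); rewrite vec2_eta.
have := h2 _ tI te2; rewrite Ys subr0 => hY /(_ hY) hL.
rewrite normrM normrM normrN normfV (gtr0_norm lam_gt0) (@ger0_norm _ 4) //.
have -> : 4 / (1 + lam ^+ 2) * (L + 2 * pi) * `|sep t 1 0| =
    4 * ((L + 2 * pi) * `|sep t 1 0|) / (1 + lam ^+ 2) by ring.
rewrite ler_wpM2r ?invr_ge0 ?(ltW lam_gt0) // ler_wpM2l //.
rewrite /force (le_trans (ler_normD _ _)) // [(L + _) * _]mulrDl lerD //.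
by rewrite normrM ger0_norm // mulr_ge0 ?pi_ge0.
Qed.

End Solution.

(** * The trajectories *)

Section Trajectory.
Variable R : realType.

Lemma image_interval (T : \bar R) (X : R -> R) :
  {within lifespan T, continuous X} -> is_interval [set X t | t in lifespan T].
Proof.
move=> cX; apply/connected_intervalP/connected_continuous_connected => //.
exact/connected_intervalP/lifespan_interval.
Qed.

(** An interval that contains u and v with u + 1 <= v contains the integer part
    of v. *)
Lemma interval_avoiding_int (I : set R) (x y : R) : is_interval I ->
  (forall k : int, ~ I k%:~R) -> I x -> I y -> `|y - x| < 1.
Proof.
move=> iI nZ.
suff main u v : I u -> I v -> v - u < 1.
  move=> Ix Iy; rewrite ltr_norml.
  have := main _ _ Ix Iy; have := main _ _ Iy Ix.
  by move=> *; apply/andP; split; lra.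
move=> Iu Iv; rewrite ltNge; apply/negP => uv.
have /andP[h1 h2] := floor_itv v; apply: (nZ (Num.floor v)).
by apply: (iI u v) => //; rewrite h1 andbT; rewrite rmorphD /= in h2; lra.
Qed.

End Trajectory.

Theorem lemma5p2 (R : realType) (lam : R) (F : torus R -> R)
    (alpha0 beta0 : R) (a0 : 'I_2 -> torus R) (q0 : 'cV[R]_2)
    (T : \bar R) (a : R -> 'I_2 -> torus R) (q : R -> 'cV[R]_2) :
  is_green F ->
  distinct_pair a0 ->
  a0 0 = to_torus (vec2 2^-1 2^-1 + vec2 alpha0 beta0) ->
  a0 1 = to_torus (vec2 2^-1 2^-1 + vec2 (- alpha0) beta0) ->
  q0 = (2 * pi) *: ((vec2 2^-1 2^-1 + vec2 alpha0 beta0)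
                    - (vec2 2^-1 2^-1 + vec2 (- alpha0) beta0)) ->
  (0 < T)%E ->
  is_solution lam F a0 q0 T a q ->
  (exists alpha beta : R -> R,
    let G (s : R) :=
      partial 0 (F \o @to_torus R) (vec2 (2 * s) 0) + 4 * pi * s in
    [/\ alpha 0 = alpha0 /\ beta 0 = beta0,
        {within lifespan T, continuous alpha}
          /\ {within lifespan T, continuous beta},
        forall t, 0 < t -> (t%:E < T)%E ->
          is_derive t 1 alpha (- 2 * G (alpha t) / (1 + lam ^+ 2))
          /\ is_derive t 1 beta (2 * lam * G (alpha t) / (1 + lam ^+ 2))
      & forall t, lifespan T t ->
          a t 0 = to_torus (vec2 2^-1 2^-1 + vec2 (alpha t) (beta t))
          /\ a t 1 = to_torus (vec2 2^-1 2^-1 + vec2 (- alpha t) (beta t))])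
  /\ (forall j, is_segment [set a t j | t in lifespan T]).
Proof.
move=> gF _ a00 a01 q0E T0 sol.
have Z0 : lifespan T 0 by exact: lifespan0.
have vecD (x y x' y' : R) : vec2 x y + vec2 x' y' = vec2 (x + x') (y + y').
  by apply: cV2P; rewrite !mxE.
have sep0 : sep q 0 = vec2 (2 * alpha0) 0.
  rewrite /sep (flux_init sol) q0E scalerA mulVf; last first.
    by rewrite mulf_neq0 // gt_eqF ?pi_gt0.
  by rewrite scale1r; apply: cV2P; rewrite !mxE /=; ring.
have Y0 : forall t, lifespan T t -> sep q t 1 0 = 0.
  by apply: (sep1_eq0 gF sol); rewrite sep0 vec2E1.
pose alpha t := 2^-1 * sep q t 0 0.
(* beta' = - lam alpha' in the system, so this choice is forced *)
pose beta t := beta0 - lam * (alpha t - alpha0).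
have sepE t : lifespan T t -> sep q t = vec2 (2 * alpha t) 0.
  move=> Tt; rewrite -[LHS]vec2_eta Y0 // /alpha; congr (vec2 _ _).
  by rewrite mulrA divff // mul1r.
have alpha_0 : alpha 0 = alpha0.
  by rewrite /alpha sep0 vec2E0 mulrA mulVf // mul1r.
have beta_0 : beta 0 = beta0 by rewrite /beta alpha_0 subrr mulr0 subr0.
have calpha : {within lifespan T, continuous alpha}.
  apply: (within_comp (@sep_continuous _ _ _ _ _ _ _ _ sol 0)).
  exact: mulrl_continuous.
have caff (b l u : R) : continuous (fun x : R => b + l * (x - u)).
  move=> x; apply: differentiable_continuous; apply/derivable1_diffP.
  exact: ex_derive.
have cbeta : {within lifespan T, continuous beta}.
  have -> : beta = (fun t => beta0 + (- lam) * (alpha t - alpha0)).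
    by apply/funext => t; rewrite /beta mulNr.
  exact: within_comp calpha (caff beta0 (- lam) alpha0).
pose G (s : R) := partial 0 (F \o @to_torus R) (vec2 (2 * s) 0) + 4 * pi * s.
have force0 t : lifespan T t -> force F q t 0 = G (alpha t).
  by move=> Tt; rewrite /force sepE // vec2E0 /G; congr (_ + _); ring.
have force1 t : lifespan T t -> force F q t 1 = 0.
  move=> Tt; have := sep_neq0 sol Tt; rewrite /force sepE // => nz.
  by rewrite (partial1_axis gF) // vec2E1 mulr0 addr0.
have dalpha t : interior_time T t ->
    is_derive t 1 alpha (- 2 * G (alpha t) / (1 + lam ^+ 2)).
  move=> it; have Tt := interior_lifespan it.
  have := is_deriveZ 2^-1 (sep_derive gF sol 0 it).
  rewrite force0 // => H; apply: is_derive_eq H _.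
  by rewrite -![_ *: _]/(_ * _); field; rewrite gt_eqF // ltr_wpDr ?sqr_ge0.
have dbeta t : interior_time T t ->
    is_derive t 1 beta (2 * lam * G (alpha t) / (1 + lam ^+ 2)).
  move=> /dalpha da.
  have H := is_deriveB (is_derive_cst beta0 t 1)
    (is_deriveZ lam (is_deriveB da (is_derive_cst alpha0 t 1))).
  apply: is_derive_eq H _.
  by rewrite -![_ *: _]/(_ * _); ring.
have cshift l u : {within lifespan T, continuous (fun t => u + l * alpha t)}.
  have -> : (fun t => u + l * alpha t) = (fun t => u + l * (alpha t - 0)).
    by apply/funext => t; rewrite subr0.
  exact: within_comp calpha (caff u l 0).
have cbeta2 : {within lifespan T, continuous (fun t => 2^-1 + beta t)}.
  have -> : (fun t => 2^-1 + beta t) = (fun t => 2^-1 + 1 * (beta t - 0)).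
    by apply/funext => t; rewrite subr0 mul1r.
  exact: within_comp cbeta (caff 2^-1 1 0).
have pos (j : 'I_2) :
    a0 j = to_torus (vec2 (2^-1 + deg R j * alpha0) (2^-1 + beta0)) ->
    forall t, lifespan T t ->
    a t j = to_torus (vec2 (2^-1 + deg R j * alpha t) (2^-1 + beta t)).
  move=> a0j; apply: (@torus_curve_eq _ _ (fun t => a t j)
    (fun t => 2^-1 + deg R j * alpha t) (fun t => 2^-1 + beta t)).
  - exact: sol_continuous sol j.
  - exact: cshift.
  - exact: cbeta2.
  - by rewrite (sol_init sol) alpha_0 beta_0.
  - move=> t it; have Tt := interior_lifespan it.
    have [v [vel v0 v1]] := velocity gF sol j it.
    exists v; split; first exact: vel.
    + have H := is_deriveD (is_derive_cst (2^-1 : R) t 1)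
        (is_deriveZ (deg R j) (dalpha t it)).
      apply: is_derive_eq H _.
      by rewrite v0 force0 // force1 // -[_ *: _]/(_ * _); ring.
    + have H := is_deriveD (is_derive_cst (2^-1 : R) t 1) (dbeta t it).
      apply: is_derive_eq H _.
      by rewrite v1 force0 // force1 //; ring.
have deg0 : deg R 0 = 1 by [].
have deg1 : deg R 1 = -1 by [].
have {}pos (j : 'I_2) t : lifespan T t ->
    a t j = to_torus (vec2 (2^-1 + deg R j * alpha t) (2^-1 + beta t)).
  apply: pos; move: j; apply: ord2P; rewrite ?deg0 ?deg1 ?mul1r ?mulN1r.
    by rewrite a00 vecD.
  by rewrite a01 vecD.
split.
  exists alpha, beta; split.
  - by split; [exact: alpha_0|exact: beta_0].
  - by split; [exact: calpha|exact: cbeta].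
  - by move=> t t0 tT; split; [apply: dalpha|apply: dbeta]; split.
  - by move=> t Tt; rewrite !vecD !pos // deg0 deg1 mul1r mulN1r.
move=> j; pose I := [set alpha t - alpha0 | t in lifespan T].
exists (vec2 (2^-1 + deg R j * alpha0) (2^-1 + beta0)),
  (vec2 (deg R j) (- lam)), I.
split.
- apply/eqP => /(congr1 (fun v : 'cV[R]_2 => v 0 0)); rewrite vec2E0 mxE /deg.
  by case: ifP => _ /eqP; rewrite ?oppr_eq0 oner_eq0.
- by exists (alpha 0 - alpha0); exists 0.
- apply: image_interval.
  have -> : (fun t => alpha t - alpha0) = (fun t => - alpha0 + 1 * alpha t).
    by apply/funext => t; rewrite mul1r addrC.
  exact: cshift.
- have iX := image_interval (@sep_continuous _ _ _ _ _ _ _ _ sol 0).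
  exists 1; split; first exact: num_real.
  move=> M M1 _ [t Tt <-]; apply: ltW; apply: lt_trans M1.
  have nZ (k : int) : ~ [set sep q t 0 0 | t in lifespan T] k%:~R.
    move=> [s Ts Es]; apply: (sep_neq0 sol Ts); apply/to_torus_eq0/latticeP.
    apply: ord2P; last by rewrite Y0.
    by rewrite Es intr_int.
  have := interval_avoiding_int iX nZ (ex_intro2 _ _ 0 Z0 erefl)
    (ex_intro2 _ _ t Tt erefl).
  rewrite sepE // sep0 !vec2E0 -mulrBr normrM ger0_norm //.
  by have := normr_ge0 (alpha t - alpha0); lra.
- have E t : lifespan T t -> a t j = to_torus
      (vec2 (2^-1 + deg R j * alpha0) (2^-1 + beta0)
       + (alpha t - alpha0) *: vec2 (deg R j) (- lam)).
    move=> Tt; rewrite pos //; congr to_torus.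
    by apply: cV2P; rewrite !mxE /= /beta; ring.
  apply/seteqP; split=> z.
    by move=> [t Tt <-]; exists (alpha t - alpha0); [exists t|rewrite E].
  by move=> [_ [t Tt <-] <-]; exists t => //; rewrite E.
Qed.
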